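(* Let $K$ be a perfect field of characteristic $p>0$. Let $A_1=K\langle x,\partial \mid \partial x-x\partial=1\rangle$ be the first Weyl algebra over $K$, and let $Z=K[X,Y]$ be its centre, the polynomial algebra in $X:=x^p$ and $Y:=\partial^p$. Then the restriction map $$\mathrm{res}:\mathrm{Aut}_K(A_1)\to \mathrm{Aut}_K(Z),\qquad \sigma\mapsto \sigma|_Z,$$ is a group monomorphism whose image is $\Gamma:=\{\tau\in\mathrm{Aut}_K(Z)\mid \mathcal{J}(\tau)=1\}$.
   Context: For $\tau\in\mathrm{Aut}_K(Z)$, $\mathcal{J}(\tau)=\det\begin{pmatrix}\partial\tau(X)/\partial X & \partial\tau(X)/\partial Y\\ \partial\tau(Y)/\partial X & \partial\tau(Y)/\partial Y\end{pmatrix}$ is the Jacobian of $\tau$. The restriction $\sigma|_Z$ is an automorphism of $Z$ since any automorphism preserves the centre. *)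

(* Defs.v *)
From HB Require Import structures.
From mathcomp Require Import all_boot all_order all_algebra.
Set Implicit Arguments. Unset Strict Implicit. Unset Printing Implicit Defensive.
Import Order.TTheory GRing.Theory Num.Theory.
Local Open Scope ring_scope.

Definition perfect_pchar (K : fieldType) (p : nat) : Prop :=
  p \in [pchar K] /\ forall a : K, exists b : K, b ^+ p = a.

(* (A, x, d) is (a copy of) the first Weyl algebra A_1 = K<x, d | d x - x d = 1>:
   the defining relation holds and the standard monomials x^i d^j form a
   K-basis of A (this characterises A_1 up to isomorphism). *)
Definition is_weyl1 (K : fieldType) (A : algType K) (x d : A) : Prop :=
  [/\ d * x - x * d = 1,
      (forall a : A, exists (n : nat) (c : nat -> nat -> K),
          a = \sum_(i < n) \sum_(j < n) c i j *: (x ^+ i * d ^+ j)) &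
      (forall (n : nat) (c : nat -> nat -> K),
          \sum_(i < n) \sum_(j < n) c i j *: (x ^+ i * d ^+ j) = 0 ->
          forall i j, (i < n)%N -> (j < n)%N -> c i j = 0)].

Definition Kalg_aut (K : fieldType) (A : algType K) (s : A -> A) : Prop :=
  [/\ forall (a : K) (u v : A), s (a *: u + v) = a *: s u + s v,
      forall u v : A, s (u * v) = s u * s v,
      s 1 = 1 & bijective s].

(* The polynomial algebra Z = K[X,Y] is {poly {poly K}}: an element is
   sum_j f_j(X) Y^j, so Y = 'X and X = 'X%:P. *)
Definition polyX (K : fieldType) : {poly {poly K}} := ('X)%:P.
Definition polyY (K : fieldType) : {poly {poly K}} := 'X.

Definition Zaut (K : fieldType) (t : {poly {poly K}} -> {poly {poly K}}) : Prop :=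
  [/\ forall u v, t (u + v) = t u + t v,
      forall u v, t (u * v) = t u * t v,
      forall c : K, t (c%:P%:P) = c%:P%:P & bijective t].

Definition dX (K : fieldType) (f : {poly {poly K}}) : {poly {poly K}} :=
  map_poly (fun q : {poly K} => q^`()) f.
Definition dY (K : fieldType) (f : {poly {poly K}}) : {poly {poly K}} := f^`().

Definition jacobian (K : fieldType) (t : {poly {poly K}} -> {poly {poly K}})
  : {poly {poly K}} :=
  let tX := t (polyX K) in let tY := t (polyY K) in
  dX tX * dY tY - dY tX * dX tY.

Definition centre_emb (K : fieldType) (A : algType K) (x d : A) (p : nat)
  (f : {poly {poly K}}) : A :=
  \sum_(j < size f) \sum_(i < size f`_j)
     (f`_j)`_i *: (x ^+ (p * i) * d ^+ (p * j)).

Definition is_restriction (K : fieldType) (A : algType K) (x d : A) (p : nat)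
  (s : A -> A) (t : {poly {poly K}} -> {poly {poly K}}) : Prop :=
  forall f, centre_emb x d p (t f) = s (centre_emb x d p f).

(* Main.v *)
(* Everything reduces to automorphisms of K[X,Y]. If (P, D) are the images of
   (x, d) under an automorphism of A_1 with P^p = x^p and D^p = lam d^p, then
   comparing orders in d gives P = x and D = d + g(x), and the order in x of
   (d + g)^p - d^p forces lam = 1, g = 0; this gives injectivity, and shows that
   X |-> X, Y |-> lam Y lifts only for lam = 1. Conversely, the shears
   Y |-> Y + b(X), the swap and the tori have Jacobian 1 and lift to A_1 (K is
   perfect). So it suffices that each automorphism t of K[X,Y] becomes
   X |-> X, Y |-> lam Y after composition with such maps; then lam = J(t) up to
   an automorphism fixing constants.

   This tameness is proved in arbitrary characteristic through an additive group
   action: t carries the translation Y |-> Y + T to a homomorphism h from K[X,Y]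
   to K[X,Y][T] that fixes f = t(X). Passing to top parts for weights adapted to
   the Newton polygon of f, the top form of f is fixed by a nontrivial
   homogeneous h. The elements fixed by h are closed under factors, so this top
   form is not divisible by XY and is a product containing some X^i - r Y^j with
   r in K and i, j coprime, itself fixed by h. A derivation argument shows that
   the curve X^i - r Y^j = const has no such nontrivial parametrization unless
   i = 1 or j = 1, so that a shear lowers the degree of f. *)
Require Import Defs.
From HB Require Import structures.
From mathcomp Require Import all_boot all_order all_algebra.
From mathcomp Require Import zify ring.
Set Implicit Arguments.
Unset Strict Implicit.
Unset Printing Implicit Defensive.
Import Order.TTheory GRing.Theory Num.Theory.
Local Open Scope ring_scope.

Local Notation "{ 'poly2' K }" := {poly {poly K}} (format "{ 'poly2'  K }").

(** * Polynomials in two variables and derivations *)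

(** In characteristic $p$ the kernel of a nonzero derivation contains all $p$-th powers, so it is
    never closed under factors. The derivation to which t carries d/dY therefore says too little
    about f = t(X), and the whole translation by T is transported instead; for the resulting h,
    closure under factors is just additivity of the degree in T.

    The root r must lie in K for the shear to be defined over K, although K need not be
    algebraically closed. It is a quotient of powers of iterated leading coefficients of h(X) and
    h(Y), taken in T, then in Y, then in X: a binary form vanishing on (h(X)^i, h(Y)^j) in top
    degree also vanishes on the leading coefficients. *)

Lemma poly2_ind (K : nzRingType) (P : {poly2 K} -> Prop) :
  (forall c, P c%:P%:P) -> P ('X%:P) -> P 'X ->
  (forall u v, P u -> P v -> P (u + v)) ->
  (forall u v, P u -> P v -> P (u * v)) -> forall f, P f.
Proof.
move=> PC PX PY PD PM; have PP (q : {poly K}) : P q%:P.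
  elim/poly_ind: q => [|q c IHq]; first by have := PC 0; rewrite polyC0.
  by rewrite polyCD polyCM; apply: PD => //; apply: PM.
by elim/poly_ind => [|f c IHf]; [rewrite -polyC0 | apply: PD => //; apply: PM].
Qed.

Lemma poly2_hom_ext (K : nzRingType) (B : pzSemiRingType)
    (h1 h2 : {poly2 K} -> B) :
  (forall u v, h1 (u + v) = h1 u + h1 v) ->
  (forall u v, h1 (u * v) = h1 u * h1 v) ->
  (forall u v, h2 (u + v) = h2 u + h2 v) ->
  (forall u v, h2 (u * v) = h2 u * h2 v) ->
  (forall c, h1 c%:P%:P = h2 c%:P%:P) ->
  h1 'X%:P = h2 'X%:P -> h1 'X = h2 'X -> h1 =1 h2.
Proof.
move=> D1 M1 D2 M2 eC eX eY; elim/poly2_ind => // u v eu ev.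
  by rewrite D1 D2 eu ev.
by rewrite M1 M2 eu ev.
Qed.

(** A composition of ring morphisms, from which its own morphism structure is inferred. Through
    [phi] the same substitution serves for values in K[X,Y], in K[X,Y][T] and in a fraction
    field. *)
Definition ev2 (K B : comNzRingType) (phi : {rmorphism K -> B}) (a b : B)
    : {poly2 K} -> B :=
  horner_eval b \o map_poly (horner_eval a \o map_poly phi).

HB.instance Definition _ (K B : comNzRingType) (phi : {rmorphism K -> B})
    (a b : B) := GRing.RMorphism.on (ev2 phi a b).

Section Evaluation.
Variables (K B : comNzRingType) (phi : {rmorphism K -> B}).
Implicit Types (a b : B) (f : {poly2 K}).

Lemma ev2C a b c : ev2 phi a b c%:P%:P = phi c.
Proof.
by rewrite /ev2 /= map_polyC /= /horner_eval hornerC map_polyC /= hornerC.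
Qed.

Lemma ev2X a b : ev2 phi a b 'X%:P = a.
Proof. by rewrite /ev2 /= map_polyC /= /horner_eval hornerC map_polyX hornerX. Qed.

Lemma ev2Y a b : ev2 phi a b 'X = b.
Proof. by rewrite /ev2 /= map_polyX /horner_eval hornerX. Qed.

Lemma ev2E a b f n m :
  (size f <= n)%N -> (sizeY f <= m)%N ->
  ev2 phi a b f = \sum_(j < n) \sum_(i < m) phi f`_j`_i * a ^+ i * b ^+ j.
Proof.
move=> fn fm.
rewrite /ev2 [LHS]/horner_eval (horner_coef_wide (n := n)); last first.
  exact: leq_trans (size_poly _ _) fn.
apply: eq_bigr => j _.
rewrite (coef_map (horner_eval a \o map_poly phi)) -mulr_suml; congr (_ * _).
rewrite /= /horner_eval (horner_coef_wide (n := m)); last first.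
  exact: leq_trans (size_poly _ _) (leq_trans (max_size_coefXY _ _) fm).
by apply: eq_bigr => i _; rewrite coef_map.
Qed.

Lemma ev2_uniq (h : {poly2 K} -> B) :
  (forall u v, h (u + v) = h u + h v) ->
  (forall u v, h (u * v) = h u * h v) ->
  (forall c, h c%:P%:P = phi c) -> h =1 ev2 phi (h 'X%:P) (h 'X).
Proof.
move=> hD hM hC; apply: poly2_hom_ext => //; rewrite ?ev2X ?ev2Y //.
- exact: rmorphD.
- exact: rmorphM.
by move=> c; rewrite ev2C hC.
Qed.

End Evaluation.

Definition derivation (B : comNzRingType) (D : B -> B) : Prop :=
  (forall u v, D (u + v) = D u + D v) /\
  (forall u v, D (u * v) = D u * v + u * D v).

Section Derivation.
Variables (B : comNzRingType) (D : B -> B).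
Hypothesis derD : derivation D.

Lemma derivation0 : D 0 = 0.
Proof. by apply: (addrI (D 0)); rewrite -derD.1 !addr0. Qed.

Lemma derivation1 : D 1 = 0.
Proof.
have := derD.2 1 1; rewrite mulr1 mulr1 mul1r => /esym/eqP.
by rewrite addrC -subr_eq0 addrK => /eqP.
Qed.

Lemma derivationX u n : D (u ^+ n) = u ^+ n.-1 * D u *+ n.
Proof.
elim: n => [|n IHn]; first by rewrite expr0 derivation1 mulr0n.
rewrite exprS derD.2 IHn; case: n {IHn} => [|n]; first by rewrite expr0; ring.
by rewrite /= [u ^+ n.+1]exprS mulrSr -mulrnAr; ring.
Qed.

Lemma derivation_sum (I : Type) (r : seq I) (P : pred I) (F : I -> B) :
  D (\sum_(i <- r | P i) F i) = \sum_(i <- r | P i) D (F i).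
Proof. exact: (big_morph D derD.1 derivation0). Qed.

(** The coefficientwise extension takes the value 0 on the new variable. It yields [dX] from the
    derivative of K[X], and extends derivations of K[X,Y] to K[X,Y][T]. *)
Lemma derivation_map : derivation (map_poly D).
Proof.
have coef_D (p : {poly B}) i : (map_poly D p)`_i = D p`_i.
  by rewrite coef_map_id0 // derivation0.
split=> u v; apply/polyP => i; first by rewrite !(coef_D, coefD) derD.1.
rewrite coef_D coefD !coefM derivation_sum -big_split /=.
by apply: eq_bigr => j _; rewrite derD.2 !coef_D.
Qed.

Lemma size_map_derivation (p : {poly B}) : (size (map_poly D p) <= size p)%N.
Proof. exact: size_poly. Qed.

End Derivation.

Lemma derivation_deriv (B : comNzRingType) : derivation (@deriv B).
Proof. by split=> u v; rewrite ?derivD ?derivM. Qed.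

Lemma derivation_dX (K : fieldType) : derivation (@dX K).
Proof. exact: derivation_map (@derivation_deriv _). Qed.

Lemma derivation_dY (K : fieldType) : derivation (@dY K).
Proof. exact: derivation_deriv. Qed.

Lemma coef_dX (K : fieldType) (f : {poly2 K}) j : (dX f)`_j = (f`_j)^`().
Proof. by rewrite coef_map_id0 // (derivC 0). Qed.

Lemma dX_polyC (K : fieldType) (q : {poly K}) : dX q%:P = (q^`())%:P.
Proof. by apply/polyP=> j; rewrite coef_dX !coefC; case: eqP => // _; rewrite derivC. Qed.

Lemma dX_X (K : fieldType) : dX ('X%:P : {poly2 K}) = 1.
Proof. by rewrite dX_polyC derivX. Qed.

Lemma dX_Y (K : fieldType) : dX ('X : {poly2 K}) = 0.
Proof.
apply/polyP => i; rewrite coef_dX coefX coef0.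
by case: eqP => _; rewrite ?derivC // -(polyC1 K) derivC.
Qed.

Lemma dY_X (K : fieldType) : dY ('X%:P : {poly2 K}) = 0.
Proof. exact: derivC. Qed.

Lemma dY_Y (K : fieldType) : dY ('X : {poly2 K}) = 1.
Proof. exact: derivX. Qed.

Lemma dX_C (K : fieldType) (c : K) : dX (c%:P%:P : {poly2 K}) = 0.
Proof. by rewrite dX_polyC derivC. Qed.

Lemma dY_C (K : fieldType) (c : K) : dY (c%:P%:P : {poly2 K}) = 0.
Proof. exact: derivC. Qed.

Lemma size_mul_le1 (B : idomainType) (p q r : {poly B}) :
  p * q = r -> r != 0 -> (size r <= 1)%N -> (size p <= 1)%N /\ (size q <= 1)%N.
Proof.
move=> <-; rewrite mulf_eq0 negb_or => /andP[p0 q0]; rewrite size_mul //.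
move: p0 q0; rewrite -!size_poly_gt0; lia.
Qed.

Lemma size_expr_le1 (B : idomainType) (p : {poly B}) n :
  (0 < n)%N -> (size (p ^+ n) <= 1)%N -> (size p <= 1)%N.
Proof.
case: n => // n _; have [->|p0] := eqVneq p 0; first by rewrite size_poly0.
have := size_exp p n.+1; have := expf_neq0 n.+1 p0.
move: p0; rewrite -!size_poly_gt0; nia.
Qed.

Lemma derivationN (B : comNzRingType) (D : B -> B) u :
  derivation D -> D (- u) = - D u.
Proof. by move=> dD; apply: (addrI (D u)); rewrite -dD.1 !subrr derivation0. Qed.

Lemma derivationB (B : comNzRingType) (D : B -> B) u v :
  derivation D -> D (u - v) = D u - D v.
Proof. by move=> dD; rewrite dD.1 derivationN. Qed.

Lemma map_derivationC (B : comNzRingType) (D : B -> B) u :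
  derivation D -> map_poly D u%:P = (D u)%:P.
Proof.
move=> dD; apply/polyP=> k; rewrite coef_map_id0 ?derivation0 // !coefC.
by case: eqP => // _; rewrite derivation0.
Qed.

(** * Parametrizations of quasi-homogeneous curves *)

Section QuasiHomogeneousCurve.
Variables (B : idomainType) (a b c : B) (i j : nat) (xi eta : {poly B}).
Hypothesis c_neq0 : c != 0.
Hypothesis curve : xi ^+ i - c%:P * eta ^+ j = (a ^+ i - c * b ^+ j)%:P.

(** As i = 0 in B, applying D kills the i-th powers and leaves j c eta^(j-1) D(eta) = j c b^(j-1), a
    nonzero constant in T. Since j > 1, eta is constant, and then so is xi by the curve equation. *)
Lemma curve_char_dvd (D : B -> B) :
  derivation D -> D c = 0 -> D b = 1 -> b != 0 -> (0 < i)%N -> (1 < j)%N ->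
  i%:R = 0 :> B -> j%:R != 0 :> B -> (size xi <= 1)%N /\ (size eta <= 1)%N.
Proof.
move=> dD Dc Db b0 i0 j1 ir jr; have dDT := derivation_map dD.
have irT : i%:R = 0 :> {poly B} by rewrite -polyC_natr ir.
have E2 : eta ^+ j.-1 * ((c *+ j)%:P * map_poly D eta)
        = (c * b ^+ j.-1 *+ j)%:P.
  have /(congr1 (map_poly D)) := curve.
  rewrite derivationB // (derivationX dDT) -[_ *+ i]mulr_natr irT mulr0 sub0r.
  rewrite dDT.2 !map_derivationC // Dc mul0r add0r (derivationX dDT).
  rewrite derivationB // (derivationX dD) -[_ *+ i]mulr_natr ir mulr0 sub0r.
  rewrite dD.2 Dc mul0r add0r (derivationX dD) Db mulr1 polyCN.
  by move=> /oppr_inj E; rewrite -[c * _ *+ j]mulrnAr -E polyCMn; ring.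
have [||/size_expr_le1 se _] := size_mul_le1 E2.
- by rewrite polyC_eq0 -mulr_natr !mulf_neq0 // expf_neq0.
- exact: size_polyC_leq1.
have {}se : (size eta <= 1)%N by apply: se; lia.
split=> //; apply: (size_expr_le1 i0).
rewrite -[xi ^+ i](subrK (c%:P * eta ^+ j)) curve (size1_polyC se).
by rewrite -rmorphXn -rmorphM -rmorphD size_polyC_leq1.
Qed.

(* For a derivation with D a = c j b^(j-1) and D b = i a^(i-1), which kills the
   constant z = a^i - c b^j, the curve equation forces eta^(j-1) to divide
   i z (D xi) and xi^(i-1) to divide j z (D eta); compare degrees. *)
Lemma curve_char_ndvd (D : B -> B) :
  derivation D -> D c = 0 -> D a = c * b ^+ j.-1 *+ j -> D b = a ^+ i.-1 *+ i ->
  a != 0 -> b != 0 -> a ^+ i - c * b ^+ j != 0 ->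
  xi`_0 = a -> eta`_0 = b ->
  i%:R != 0 :> B -> j%:R != 0 :> B -> (1 < i)%N -> (1 < j)%N ->
  (2 < i)%N || (2 < j)%N -> (size xi <= 1)%N /\ (size eta <= 1)%N.
Proof.
set z := a ^+ i - _ => dD Dc Da Db a0 b0 z0 xi0 eta0 ir jr i1 j1 ij.
have dDT := derivation_map dD.
set xD := map_poly D xi; set eD := map_poly D eta.
(* A weighted Wronskian: W / (xi eta) is the logarithmic derivative of eta^j / xi^i. *)
pose W : {poly B} := xi * eD *+ j - eta * xD *+ i.
have Dz : D z = 0.
  rewrite derivationB // dD.2 Dc !(derivationX dD) Da Db; ring.
have key : xi ^+ i.-1 * xD *+ i = c%:P * eta ^+ j.-1 * eD *+ j.
  have /(congr1 (map_poly D)) := curve.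
  rewrite map_derivationC // Dz polyC0 derivationB // (derivationX dDT) dDT.2.
  rewrite map_derivationC // Dc mul0r add0r (derivationX dDT).
  by move/subr0_eq; rewrite -/xD -/eD => ->; ring.
have xiE : xi ^+ i = xi * xi ^+ i.-1 by rewrite -exprS prednK //; lia.
have etaE : eta ^+ j = eta * eta ^+ j.-1 by rewrite -exprS prednK //; lia.
have ExD : z%:P * xD *+ i = c%:P * eta ^+ j.-1 * W.
  have -> : z%:P * xD *+ i
      = xi * (xi ^+ i.-1 * xD *+ i) - c%:P * eta ^+ j * xD *+ i.
    by rewrite -curve xiE; ring.
  by rewrite key etaE /W; ring.
have EeD : z%:P * eD *+ j = xi ^+ i.-1 * W.
  have -> : z%:P * eD *+ j
      = xi ^+ i * eD *+ j - eta * (c%:P * eta ^+ j.-1 * eD *+ j).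
    by rewrite -curve etaE; ring.
  by rewrite -key xiE /W; ring.
have coefDT (p : {poly B}) : (map_poly D p)`_0 = D p`_0.
  by rewrite coef_map_id0 ?derivation0.
have nz (p : {poly B}) : p`_0 != 0 -> p != 0.
  by apply: contraNneq => ->; rewrite coef0.
have xD0 : xD != 0.
  by apply: nz; rewrite coefDT xi0 Da -mulr_natr !mulf_neq0 // expf_neq0.
have eD0 : eD != 0.
  by apply: nz; rewrite coefDT eta0 Db -mulr_natr !mulf_neq0 // expf_neq0.
have szn (p q : {poly B}) n d : n%:R != 0 :> B -> d != 0 -> p != 0 -> d%:P * p *+ n = q ->
    size p = size q /\ q != 0.
  move=> nr d0 p0 <-; have dn0 : d *+ n != 0 by rewrite -mulr_natr mulf_neq0.
  rewrite -mulrnAl -polyCMn mul_polyC size_scale //.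
  by rewrite -mul_polyC mulf_neq0 ?polyC_eq0.
have xin : xi != 0 by apply: nz; rewrite xi0.
have etan : eta != 0 by apply: nz; rewrite eta0.
have [sx nx] := szn _ _ _ _ ir z0 xD0 ExD.
have [se ne] := szn _ _ _ _ jr z0 eD0 EeD.
have Wn : W != 0 by move: ne; rewrite mulf_eq0 negb_or => /andP[].
move: sx; rewrite -mulrA mul_polyC size_scale // size_mul ?expf_neq0 //.
move: se; rewrite size_mul ?expf_neq0 //.
have := size_exp xi i.-1; have := size_exp eta j.-1.
have := expf_neq0 i.-1 xin; have := expf_neq0 j.-1 etan.
have := size_map_derivation D xi; have := size_map_derivation D eta.
move: xin etan Wn; rewrite -!size_poly_gt0 -/xD -/eD.
move: (size xD) (size eD) (size W) (size (xi ^+ _)) (size (eta ^+ _)).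
move: (size xi) (size eta) ij i1 j1; clear.
move=> n m ij i1 j1 sxD seD sW sxi seta n0 m0 W0 ? ? ? ? ey ex ? ?.
(* Here n - 1 = deg xi and m - 1 = deg eta. Since i - 1 and j - 1 are positive and one of them is at
   least 2, the two inequalities force both degrees to be 0. *)
have lx : (m.-1 * j.-1 <= n.-1)%N by rewrite -ey; lia.
have ly : (n.-1 * i.-1 <= m.-1)%N by rewrite -ex; lia.
suff : n.-1 = 0%N /\ m.-1 = 0%N by lia.
have {lx} : (m.-1 * (1 + (2 < j)) <= n.-1)%N.
  by apply: leq_trans lx; rewrite leq_mul2l; lia.
have {ly} : (n.-1 * (1 + (2 < i)) <= m.-1)%N.
  by apply: leq_trans ly; rewrite leq_mul2l; lia.
by case/orP: ij => ->; lia.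
Qed.
End QuasiHomogeneousCurve.

Lemma natr_neq0_coprime (K : fieldType) i j : coprime i j -> (0 < i)%N ->
  i%:R = 0 :> K -> j%:R != 0 :> K.
Proof.
move=> cij i0 ir; apply/negP => jr.
have [p chp] : exists p, p \in [pchar K] by apply: natf0_pchar i0 _; apply/eqP.
have pd : (p %| gcdn i j)%N.
  by rewrite dvdn_gcd !(dvdn_pcharf chp) ir eqxx.
by have := pcharf_prime chp; rewrite (eqP cij) dvdn1 in pd; rewrite (eqP pd).
Qed.

Lemma derivation_lin (B : comNzRingType) (D1 D2 : B -> B) (u v : B) :
  derivation D1 -> derivation D2 -> derivation (fun f => u * D1 f + v * D2 f).
Proof.
by move=> d1 d2; split=> f g; rewrite ?d1.1 ?d2.1 ?d1.2 ?d2.2; ring.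
Qed.

(** Exchanges the two variables in the curve equation, with c replaced by its inverse; this reduces
    the case j = 0 in K to the case i = 0. *)
Lemma binomial_swap (B : comNzRingType) (c cv s t z : B) :
  cv * c = 1 -> s - c * t = z -> t - cv * s = - (cv * z).
Proof. by move=> cK <-; rewrite mulrBr mulrA cK mul1r opprB. Qed.

Lemma natr_poly2 (K : fieldType) n : (n%:R == 0 :> {poly2 K}) = (n%:R == 0 :> K).
Proof. by rewrite -!polyC_natr !polyC_eq0. Qed.

Lemma polyX2_neq0 (K : fieldType) : ('X%:P : {poly2 K}) != 0.
Proof. by rewrite polyC_eq0 polyX_eq0. Qed.

Lemma binomial2_neq0 (K : fieldType) (c : K) i j : (0 < i)%N -> (0 < j)%N ->
  'X%:P ^+ i - c%:P%:P * 'X ^+ j != 0 :> {poly2 K}.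
Proof.
move=> i0 j0; apply/eqP => /(congr1 (horner_eval 0)) /eqP.
rewrite rmorphB rmorphM !rmorphXn /= /horner_eval !hornerE expr0n /=.
by rewrite -[j == 0]negbK -lt0n j0 mulr0 subr0 expf_eq0 i0 polyX_eq0.
Qed.

(** Coprime i and j cannot both vanish in K. If i vanishes, d/dY is used; if j does, d/dX after an
    exchange of variables; otherwise a derivation that kills the equation of the curve. *)
Lemma quasihomogeneous_curve (K : fieldType) (c : K) i j
    (xi eta : {poly {poly2 K}}) :
  c != 0 -> (0 < i)%N -> (0 < j)%N -> coprime i j ->
  xi`_0 = 'X%:P -> eta`_0 = 'X ->
  xi ^+ i - c%:P%:P%:P * eta ^+ j = ('X%:P ^+ i - c%:P%:P * 'X ^+ j)%:P ->
  ~~ ((size xi <= 1) && (size eta <= 1))%N -> (i == 1) || (j == 1)%N.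
Proof.
move=> c0 i0 j0 cij xi0 eta0 E nc; apply/negPn/negP; rewrite negb_or => /andP[i1 j1].
have {}i1 : (1 < i)%N by lia.
have {}j1 : (1 < j)%N by lia.
have cc0 : c%:P%:P != 0 :> {poly2 K} by rewrite !polyC_eq0.
have X0 := polyX2_neq0 K; have Y0 : 'X != 0 :> {poly2 K} by rewrite polyX_eq0.
apply: (negP nc); apply/andP.
have [ir|ir] := eqVneq (i%:R : {poly2 K}) 0.
  apply: (curve_char_dvd cc0 E (@derivation_dY K)); rewrite ?dY_C ?dY_Y //.
  rewrite natr_poly2; apply: natr_neq0_coprime cij i0 _.
  by apply/eqP; rewrite -natr_poly2 ir.
have [jr|jr] := eqVneq (j%:R : {poly2 K}) 0.
  have cv0 : (c^-1)%:P%:P != 0 :> {poly2 K} by rewrite !polyC_eq0 invr_eq0.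
  suff: (size eta <= 1)%N /\ (size xi <= 1)%N by case.
  apply: (curve_char_dvd cv0 _ (@derivation_dX K) (b := 'X%:P) (a := 'X) (i := j) (j := i));
    rewrite ?dX_C ?dX_X //.
  have cv : (c^-1)%:P%:P * c%:P%:P = 1 :> {poly2 K} by rewrite -!polyCM mulVf.
  have cvT : (c^-1)%:P%:P%:P * c%:P%:P%:P = 1 :> {poly {poly2 K}} by rewrite -polyCM cv.
  rewrite (binomial_swap cvT E) -polyCM -polyCN; congr _%:P.
  by rewrite (binomial_swap cv erefl).
(* The Hamiltonian derivation F_X d/dY - F_Y d/dX of F = X^i - c Y^j. *)
pose D (f : {poly2 K}) := (c%:P%:P * 'X ^+ j.-1 *+ j) * dX f + ('X%:P ^+ i.-1 *+ i) * dY f.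
apply: (curve_char_ndvd (D := D) cc0 E) => //.
- exact: derivation_lin (@derivation_dX K) (@derivation_dY K).
- by rewrite /D dX_C dY_C !mulr0 addr0.
- by rewrite /D dX_X dY_X mulr0 addr0 mulr1.
- by rewrite /D dX_Y dY_Y mulr0 add0r mulr1.
- exact: binomial2_neq0.
(* The only case left, i = j = 2, is excluded by coprimality. *)
move: cij i1 j1; rewrite /coprime; case: (ltnP 2 i) => // i2; case: (ltnP 2 j) => // j2.
move=> + i1 j1; have -> : i = 2 by lia.
by have -> : j = 2 by lia.
Qed.

(** * Elements fixed by a homomorphism to polynomials in T *)

Lemma coef_mul_top (B : nzRingType) (u v : {poly B}) m n :
  (size u <= m.+1)%N -> (size v <= n.+1)%N -> (u * v)`_(m + n) = u`_m * v`_n.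
Proof.
move=> um vn; rewrite coefM (bigD1 (inord m)) //= inordK ?ltnS ?leq_addr //.
rewrite addKn big1 ?addr0 // => k nk.
have {nk} : (k != m :> nat).
  by apply: contra nk => /eqP km; apply/eqP/val_inj; rewrite /= inordK ?ltnS ?leq_addr.
rewrite neq_ltn => /orP[km|mk].
  by rewrite [v`_ _]nth_default ?mulr0 //; apply: leq_trans vn _; clear -km; lia.
by rewrite [u`_ _]nth_default ?mul0r //; apply: leq_trans um _.
Qed.

Lemma coef_exp_top (B : nzRingType) (u : {poly B}) m n :
  (size u <= m.+1)%N -> (u ^+ n)`_(m * n) = u`_m ^+ n.
Proof.
move=> um; elim: n => [|n IHn]; first by rewrite muln0 !expr0 coef1.
rewrite !exprS mulnS coef_mul_top ?IHn //.
apply: leq_trans (size_poly_exp_leq _ _) _; rewrite ltnS leq_mul2r; lia.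
Qed.

Lemma size_exp_le (B : nzRingType) (u : {poly B}) m n :
  (size u <= m.+1)%N -> (size (u ^+ n) <= (m * n).+1)%N.
Proof.
move=> um; apply: leq_trans (size_poly_exp_leq _ _) _.
by rewrite ltnS leq_mul2r; lia.
Qed.

Lemma size_mul_le (B : nzRingType) (u v : {poly B}) m n :
  (size u <= m.+1)%N -> (size v <= n.+1)%N -> (size (u * v)%R <= (m + n).+1)%N.
Proof.
move=> um vn; apply: leq_trans (size_polyMleq _ _) _; rewrite -subn1 leq_subLR.
by move: (leq_add um vn); clear; lia.
Qed.

Definition binform (B : nzRingType) (c : nat -> B) (g : nat) (s t : B) : B :=
  \sum_(a < g.+1) c a * s ^+ a * t ^+ (g - a).

Lemma rmorph_binform (B B' : nzRingType) (phi : {rmorphism B -> B'}) c g s t :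
  phi (binform c g s t) = binform (phi \o c) g (phi s) (phi t).
Proof.
by rewrite rmorph_sum; apply: eq_bigr => a _; rewrite !rmorphM !rmorphXn.
Qed.

Section LeadingBinaryForm.
Variables (B : idomainType) (c : nat -> B) (g i j : nat) (al be : {poly B}).
Hypotheses (c0 : c 0 != 0) (cg : c g != 0) (g0 : (0 < g)%N).
Hypotheses (al0 : al != 0) (be0 : be != 0).

(** If al^i and be^j have different degrees, the coefficient in question is c_0 or c_g times a power
    of a leading coefficient and cannot vanish. If the degrees agree, it is the form evaluated at
    the leading coefficients. *)
Lemma binform_lead :
  (binform (polyC \o c) g (al ^+ i) (be ^+ j))`_
     (maxn ((size al).-1 * i) ((size be).-1 * j) * g) = 0 ->
  binform c g (lead_coef al ^+ i) (lead_coef be ^+ j) = 0.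
Proof.
set A := (_ * i)%N; set Bd := (_ * j)%N.
have sA : (size (al ^+ i) <= A.+1)%N by apply: size_exp_le; rewrite leqSpred.
have sB : (size (be ^+ j) <= Bd.+1)%N by apply: size_exp_le; rewrite leqSpred.
have lA : (al ^+ i)`_A = lead_coef al ^+ i by rewrite coef_exp_top ?leqSpred.
have lB : (be ^+ j)`_Bd = lead_coef be ^+ j by rewrite coef_exp_top ?leqSpred.
have lA0 : lead_coef al ^+ i != 0 by rewrite expf_neq0 ?lead_coef_eq0.
have lB0 : lead_coef be ^+ j != 0 by rewrite expf_neq0 ?lead_coef_eq0.
have szT a : (size ((al ^+ i) ^+ a * (be ^+ j) ^+ (g - a))%R
              <= (A * a + Bd * (g - a)).+1)%N.
  by apply: size_mul_le; apply: size_exp_le.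
rewrite coef_sum; under eq_bigr => a _ do rewrite /= -mulrA coefCM.
case: (ltngtP A Bd) => AB; last 1 first.
- move=> E; rewrite -[RHS]E /binform; apply: eq_bigr => a _.
  have -> : (A * g = A * a + Bd * (g - a))%N.
    by rewrite -AB -mulnDr subnKC // -ltnS.
  rewrite (coef_mul_top (size_exp_le _ sA) (size_exp_le _ sB)).
  by rewrite (coef_exp_top _ sA) (coef_exp_top _ sB) lA lB mulrA.
- rewrite (bigD1 ord0) //= expr0 mul1r subn0 (coef_exp_top _ sB) lB big1 ?addr0.
    by move/eqP; rewrite mulf_eq0 (negPf c0) /= expf_eq0 (negPf lB0) andbF.
  move=> a a0; rewrite nth_default ?mulr0 //; apply: leq_trans (szT a) _.
  have := ltn_ord a; have : (0 < a)%N 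
    by rewrite lt0n; apply: contra a0 => /eqP e; apply/eqP/val_inj.
  by move: AB; clear; nia.
rewrite (bigD1 ord_max) //= subnn expr0 mulr1 (coef_exp_top _ sA) lA big1 ?addr0.
  by move/eqP; rewrite mulf_eq0 (negPf cg) /= expf_eq0 (negPf lA0) andbF.
move=> a a0; rewrite nth_default ?mulr0 //; apply: leq_trans (szT a) _.
have : (a < g)%N.
  by have := ltn_ord a; rewrite ltnS leq_eqVlt => /orP[/eqP e|//]; case/eqP: a0; apply/val_inj.
by move: AB; clear; nia.
Qed.
End LeadingBinaryForm.

(** A homogeneous factor theorem: subtract the vanishing value of the form at (rt, t) and divide
    each s^a - (rt)^a by s - rt. *)
Lemma binform_factor (K : comNzRingType) (B : comNzRingType)
    (phi : {rmorphism K -> B}) (c : nat -> K) g r (s t : B) :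
  binform c g r 1 = 0 ->
  exists q, binform (phi \o c) g s t = (s - phi r * t) * q.
Proof.
move=> E; pose q := \sum_(a < g.+1) phi (c a) * t ^+ (g - a) *
   \sum_(l < a) s ^+ (a.-1 - l) * (phi r * t) ^+ l.
have Z : binform (phi \o c) g (phi r * t) t = 0.
  have := congr1 phi E; rewrite rmorph_binform rmorph0 rmorph1 => /(congr1 ( *%R^~ (t ^+ g))).
  rewrite mul0r => <-; rewrite /binform mulr_suml; apply: eq_bigr => a _.
  rewrite exprMn expr1n mulr1 mulrA -!mulrA -exprD subnKC // -ltnS //.
exists q; rewrite -[LHS]subr0 -Z -sumrB mulr_sumr; apply: eq_bigr => a _.
rewrite -mulrBl -mulrBr subrXX; ring.
Qed.

Lemma rmorph_binomial (B B' : comNzRingType) (h : {rmorphism B -> B'}) u v w i j :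
  h (u ^+ i - v * w ^+ j) = h u ^+ i - h v * h w ^+ j.
Proof. by rewrite rmorphB rmorphM !rmorphXn. Qed.

(* h stands for an action of the additive group with parameter T, but only
   h = id at T = 0 is needed. *)
Section Coaction.
Variables (B : idomainType) (h : {rmorphism B -> {poly B}}).
Hypothesis h0 : forall f, (h f)`_0 = f.

Lemma coaction_const f : (size (h f) <= 1)%N -> h f = f%:P.
Proof. by move/size1_polyC; rewrite h0. Qed.

(** Degrees in T add up in a domain, so factors of an element constant in T are constant in T; their
    value at T = 0 is then the whole of them. *)
Lemma coaction_factor f1 f2 : f1 * f2 != 0 -> h (f1 * f2) = (f1 * f2)%:P ->
  h f1 = f1%:P /\ h f2 = f2%:P.
Proof.
move=> n0; rewrite rmorphM => /size_mul_le1[||/coaction_const-> /coaction_const->] //.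
  by rewrite polyC_eq0.
exact: size_polyC_leq1.
Qed.

Variables (x y : B).
Hypothesis nonconst : ~~ ((size (h x) <= 1) && (size (h y) <= 1))%N.

Lemma coaction_mulXY q : x * y * q != 0 -> h (x * y * q) <> (x * y * q)%:P.
Proof.
move=> n0 /(coaction_factor n0)[I _].
have n1 : x * y != 0 by move: n0; rewrite mulf_eq0 negb_or => /andP[].
have [hx hy] := coaction_factor n1 I.
by move: nonconst; rewrite hx hy !size_polyC_leq1.
Qed.

(** The form in h(x) and h(y) is constant in T, while its formal top degree in T is positive because
    h(x) or h(y) involves T. Its coefficient there is therefore 0, as [binform_lead] requires. *)
Lemma coaction_binform_lead (c : nat -> B) g i j :
  (forall a, h (c a) = (c a)%:P) ->
  (0 < i)%N -> (0 < j)%N -> (0 < g)%N -> c 0 != 0 -> c g != 0 ->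
  x != 0 -> y != 0 ->
  h (binform c g (x ^+ i) (y ^+ j)) = (binform c g (x ^+ i) (y ^+ j))%:P ->
  binform c g (lead_coef (h x) ^+ i) (lead_coef (h y) ^+ j) = 0.
Proof.
move=> hc i0 j0 g0 c0 cg x0 y0 If.
have hn0 f : f != 0 -> h f != 0.
  by move=> f0; apply: contra_neq f0 => hf; rewrite -(h0 f) hf coef0.
apply: binform_lead => //; rewrite ?hn0 //.
have -> : binform (polyC \o c) g (h x ^+ i) (h y ^+ j) = h (binform c g (x ^+ i) (y ^+ j)).
  rewrite rmorph_binform !rmorphXn; apply: eq_bigr => a _.
  by rewrite /= hc.
rewrite If [LHS]coefC -(negbK (_ == 0)%N) -lt0n muln_gt0 g0 andbT leq_max.
rewrite !muln_gt0 i0 j0 !andbT -!subn1 !subn_gt0.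
by move: nonconst; rewrite negb_and -!ltnNge => ->.
Qed.

Lemma coaction_binomial_factor i j r q : h r = r%:P ->
  (x ^+ i - r * y ^+ j) * q != 0 ->
  h ((x ^+ i - r * y ^+ j) * q) = ((x ^+ i - r * y ^+ j) * q)%:P ->
  h x ^+ i - r%:P * h y ^+ j = (x ^+ i - r * y ^+ j)%:P.
Proof.
by move=> hr n0 /(coaction_factor n0)[Iz _]; rewrite -Iz rmorph_binomial hr.
Qed.
End Coaction.

(** Leading coefficients in Y and then in X bring the zero of the form down to K; homogeneity allows
    division by its second coordinate. *)
Lemma binform_root (K : fieldType) (c : nat -> K) g i j (al be : {poly2 K}) :
  (0 < g)%N -> c 0 != 0 -> c g != 0 -> al != 0 -> be != 0 ->
  binform (polyC \o (polyC \o c)) g (al ^+ i) (be ^+ j) = 0 ->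
  exists2 r, r != 0 & binform c g r 1 = 0.
Proof.
move=> g0 c0 cg al0 be0 E1.
have E2 : binform (polyC \o c) g (lead_coef al ^+ i) (lead_coef be ^+ j) = 0.
  by apply: binform_lead; rewrite /= ?polyC_eq0 // E1 coef0.
set a2 := lead_coef al in E2; set b2 := lead_coef be in E2.
have a20 : a2 != 0 by rewrite lead_coef_eq0.
have b20 : b2 != 0 by rewrite lead_coef_eq0.
have E3 : binform c g (lead_coef a2 ^+ i) (lead_coef b2 ^+ j) = 0.
  by apply: binform_lead; rewrite // E2 coef0.
exists (lead_coef a2 ^+ i / lead_coef b2 ^+ j).
  by rewrite mulf_neq0 ?invr_eq0 ?expf_neq0 ?lead_coef_eq0.
have b30 : lead_coef b2 ^+ j != 0 by rewrite expf_neq0 ?lead_coef_eq0.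
have: lead_coef b2 ^+ j ^+ g * binform c g (lead_coef a2 ^+ i / lead_coef b2 ^+ j) 1 = 0.
  rewrite -[RHS]E3 mulr_sumr; apply: eq_bigr => a _.
  rewrite expr1n mulr1 expr_div_n mulrCA -mulrA; congr (_ * _).
  rewrite mulrCA; congr (_ * _).
  by rewrite expfB_cond // (negPf b30) -ltnS ltn_ord.
by move/eqP; rewrite mulf_eq0 expf_eq0 (negPf b30) andbF => /eqP.
Qed.

Definition polyC2 (K : comNzRingType) : K -> {poly2 K} := polyC \o polyC.
HB.instance Definition _ (K : comNzRingType) := GRing.RMorphism.on (@polyC2 K).

Lemma coaction_binform (K : fieldType) (h : {rmorphism {poly2 K} -> {poly {poly2 K}}})
    (c : nat -> K) g i j :
  (forall f, (h f)`_0 = f) -> (forall a : K, h a%:P%:P = a%:P%:P%:P) ->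
  ~~ ((size (h 'X%:P) <= 1) && (size (h 'X) <= 1))%N ->
  (0 < i)%N -> (0 < j)%N -> coprime i j -> (0 < g)%N -> c 0 != 0 -> c g != 0 ->
  let f := binform (@polyC2 K \o c) g ('X%:P ^+ i) ('X ^+ j) in
  f != 0 -> h f = f%:P ->
  (exists r, binform c g r 1 = 0) /\ ((i == 1) || (j == 1))%N.
Proof.
move=> h0 hC nonconst i0 j0 cij g0 c0 cg f f0 If.
have cC k : c k != 0 -> (@polyC2 K \o c) k != 0 by rewrite /= !polyC_eq0.
have X0 := polyX2_neq0 K; have Y0 : 'X != 0 :> {poly2 K} by rewrite polyX_eq0.
have lead0 k : k != 0 -> lead_coef (h k) != 0.
  move=> k0; rewrite lead_coef_eq0; apply: contra_neq k0 => hk.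
  by rewrite -(h0 k) hk coef0.
have hc a : h ((@polyC2 K \o c) a) = ((@polyC2 K \o c) a)%:P by rewrite hC.
have [r r0 rE] := binform_root g0 c0 cg (lead0 _ X0) (lead0 _ Y0)
  (coaction_binform_lead h0 nonconst hc i0 j0 g0 (cC _ c0) (cC _ cg) X0 Y0 If).
split; first by exists r.
(* X^i - r Y^j divides the fixed element f, hence is fixed, so h(X) and h(Y) parametrize the curve
   of [quasihomogeneous_curve]. *)
have [q fE] := binform_factor (@polyC2 K) ('X%:P ^+ i) ('X ^+ j) rE.
rewrite -/f in fE; rewrite fE in f0 If.
have := coaction_binomial_factor h0 (hC r) f0 If.
by move/(quasihomogeneous_curve r0 i0 j0 cij (h0 _) (h0 _)); apply.
Qed.

(** * Top parts for a weight *)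

(** The weight is an integer because the weights N + R k that occur for the coefficients of T^k can
    be negative; the part is then 0. *)
Definition top_form (K : nzRingType) (w1 w2 : nat) (N : int) (f : {poly2 K}) : {poly2 K} :=
  \poly_(j < size f) \poly_(i < sizeY f)
    (if (w1 * i + w2 * j)%N == N :> int then f`_j`_i else 0).

Section TopForm.
Variables (K : nzRingType) (w1 w2 : nat) (N : int).
Implicit Type f : {poly2 K}.

Lemma coef_top_form f i j : (top_form w1 w2 N f)`_j`_i =
  if (w1 * i + w2 * j)%N == N :> int then f`_j`_i else 0.
Proof.
rewrite coef_poly; case: ltnP => [_|sj]; last first.
  by rewrite [f`_j]nth_default // !coef0; case: ifP.
rewrite coef_poly; case: ltnP => // si.
by rewrite [f`_j`_i]nth_default ?if_same // (leq_trans (max_size_coefXY _ _)).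
Qed.

Lemma size_top_form f : (size (top_form w1 w2 N f) <= size f)%N.
Proof. exact: size_poly. Qed.

Lemma sizeY_top_form f : (sizeY (top_form w1 w2 N f) <= sizeY f)%N.
Proof.
apply/bigmax_leqP => j _; apply/leq_sizeP => i si.
rewrite coef_top_form [f`_j`_i]nth_default ?if_same //.
exact: leq_trans (max_size_coefXY _ _) si.
Qed.
End TopForm.

Definition weight_le (K : nzRingType) (w1 w2 : nat) (N : int) (f : {poly2 K}) : Prop :=
  forall i j, f`_j`_i != 0 -> (w1 * i + w2 * j)%N%:Z <= N.

Section Homogenization.
Variables (K : comNzRingType) (D : idomainType) (phi : {rmorphism K -> D}).
Local Notation E := {fraction {poly D}}.
Variable theta : {rmorphism D -> E}.
Local Notation "h %:F" := (@FracField.tofrac {poly D} h).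
Local Notation e := (('X : {poly D})%:F).

(* When theta maps x, y, T to e^-w1 x, e^-w2 y, e^R T, this says that H is the
   homogenization of h in weight N, with e as homogenizing variable; H.[0] is
   then the component of h of weight N. *)
Definition homog (N : int) (h : D) (H : {poly D}) : Prop := H%:F = e ^ N * theta h.

Lemma e_neq0 : e != 0.
Proof. by rewrite tofrac_eq0 polyX_eq0. Qed.

Lemma homog_inj N h H H' : homog N h H -> homog N h H' -> H = H'.
Proof. by move=> e1 e2; apply/eqP; rewrite -tofrac_eq e1 e2. Qed.

Lemma homogM N M g h G H : homog N g G -> homog M h H -> homog (N + M) (g * h) (G * H).
Proof.
move=> e1 e2; rewrite /homog tofracM e1 e2 rmorphM expfzDr ?e_neq0 //.
by rewrite mulrACA.
Qed.

Lemma homogD N g h G H : homog N g G -> homog N h H -> homog N (g + h) (G + H).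
Proof. by rewrite /homog => e1 e2; rewrite tofracD e1 e2 rmorphD mulrDr. Qed.

Lemma homog0 N : homog N 0 0.
Proof. by rewrite /homog tofrac0 rmorph0 mulr0. Qed.

Lemma homog_sum N (I : Type) (r : seq I) (P : pred I) (F : I -> D) (G : I -> {poly D}) :
  (forall i, P i -> homog N (F i) (G i)) ->
  homog N (\sum_(i <- r | P i) F i) (\sum_(i <- r | P i) G i).
Proof.
by move=> FG; apply: (big_rec2 (homog N)) => [|i g h /FG]; [exact: homog0|exact: homogD].
Qed.

Lemma homog1 : homog 0 1 1.
Proof. by rewrite /homog tofrac1 rmorph1 mulr1. Qed.

Lemma homogX N h H n : homog N h H -> homog (N * n%:Z) (h ^+ n) (H ^+ n).
Proof.
move=> e1; elim: n => [|n IHn]; first by rewrite mulr0; apply: homog1.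
by rewrite !exprS intS mulrDr mulr1; apply: homogM.
Qed.

Lemma homog_shift N h H (k : nat) : homog N h H -> homog (N + k%:Z) h (H * 'X^k).
Proof.
move=> e1; rewrite /homog tofracM tofracXn e1 expfzDr ?e_neq0 //.
by rewrite mulrAC.
Qed.

Lemma homog_id N h : theta h = e ^ (- N) * (h%:P)%:F -> homog N h h%:P.
Proof. by rewrite /homog => ->; rewrite mulrA -expfzDr ?e_neq0 // subrr mul1r. Qed.

Variables (w1 w2 : nat).
Hypothesis homogC : forall c, homog 0 (phi c) (phi c)%:P.

(** Each monomial is multiplied by e to the power N minus its weight, which is nonnegative by
    [weight_le]; at e = 0 only the monomials of weight N survive. *)
Lemma homog_ev2 N f xi eta Xi Eta :
  weight_le w1 w2 N f -> homog w1%:Z xi Xi -> homog w2%:Z eta Eta ->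
  exists2 H, homog N (ev2 phi xi eta f) H &
    H.[0] = ev2 phi Xi.[0] Eta.[0] (top_form w1 w2 N f).
Proof.
move=> wf hX hE.
exists (\sum_(j < size f) \sum_(i < sizeY f)
   ((phi f`_j`_i)%:P * Xi ^+ i * Eta ^+ j * 'X^(absz (N - (w1 * i + w2 * j)%N%:Z)))).
  rewrite (ev2E _ _ _ (leqnn _) (leqnn _)).
  apply: homog_sum => j _; apply: homog_sum => i _.
  have [->|nz] := eqVneq (f`_j`_i) 0.
    by rewrite rmorph0 !mul0r; apply: homog0.
  set k := absz _; have Nk : N = (w1 * i + w2 * j)%N%:Z + k%:Z.
    by rewrite gez0_abs ?subr_ge0 ?wf // subrKC.
  rewrite [X in homog X]Nk; apply: homog_shift; rewrite PoszD !PoszM; apply: homogM (homogX j hE).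
  by rewrite -[X in homog X]add0r; apply: homogM (homogC _) (homogX i hX).
rewrite (ev2E _ _ _ (size_top_form _ _ _ _) (sizeY_top_form _ _ _ _)).
rewrite horner_sum; apply: eq_bigr => j _.
rewrite horner_sum; apply: eq_bigr => i _; rewrite coef_top_form.
rewrite !hornerM !horner_exp hornerC hornerX expr0n absz_eq0 subr_eq0 [N == _]eq_sym.
by case: eqP; rewrite ?mulr1 // mulr0 rmorph0 !mul0r.
Qed.

Variables (x y T : D) (R : int).
Hypotheses (homog_x : homog w1%:Z x x%:P) (homog_y : homog w2%:Z y y%:P).
Hypothesis homog_T : homog (- R) T T%:P.

Lemma homog_ev2_id N f : weight_le w1 w2 N f ->
  exists2 H, homog N (ev2 phi x y f) H & H.[0] = ev2 phi x y (top_form w1 w2 N f).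
Proof. by move=> /homog_ev2/(_ homog_x homog_y); rewrite !hornerC. Qed.

(** T has weight -R, so the coefficient of T^k may have weight up to N + R k. *)
Lemma homog_poly N n (f : nat -> {poly2 K}) :
  (forall k : nat, weight_le w1 w2 (N + R * k%:Z) (f k)) ->
  exists2 H, homog N (\sum_(k < n) ev2 phi x y (f k) * T ^+ k) H &
    H.[0] = \sum_(k < n) ev2 phi x y (top_form w1 w2 (N + R * k%:Z) (f k)) * T ^+ k.
Proof.
move=> wf; elim: n => [|n [H hH H0]].
  by exists 0; rewrite ?horner0 big_ord0 //; apply: homog0.
have [G hG G0] := homog_ev2_id (wf n).
exists (H + G * T%:P ^+ n); last first.
  by rewrite big_ord_recr /= -H0 -G0 hornerD hornerM horner_exp hornerC.
rewrite big_ord_recr /=; apply: homogD => //.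
by have := homogM hG (homogX n homog_T); rewrite mulNr addrK.
Qed.

(** Both sides of the invariance equation have homogenizations of weight N, which coincide by
    uniqueness; their values at e = 0 are the two sides of the conclusion. *)
Lemma top_form_invariant N f xi eta Xi Eta :
  weight_le w1 w2 N f -> homog w1%:Z xi Xi -> homog w2%:Z eta Eta ->
  ev2 phi xi eta f = ev2 phi x y f ->
  ev2 phi Xi.[0] Eta.[0] (top_form w1 w2 N f) = ev2 phi x y (top_form w1 w2 N f).
Proof.
move=> wf hX hE E12; have [H hH <-] := homog_ev2 wf hX hE.
have [H' hH' <-] := homog_ev2_id wf.
by rewrite E12 in hH; rewrite (homog_inj hH hH').
Qed.
End Homogenization.

(** * Homogenization by rescaling the variables *)

Definition polyC3 (K : comNzRingType) : K -> {poly {poly2 K}} := polyC \o @polyC2 K.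
HB.instance Definition _ (K : comNzRingType) := GRing.RMorphism.on (@polyC3 K).

Lemma ev2_polyC3 (K : comNzRingType) (f : {poly2 K}) :
  @ev2 K {poly {poly2 K}} (@polyC3 K) 'X%:P%:P 'X%:P f = f%:P.
Proof.
apply: esym.
exact: (@ev2_uniq K {poly {poly2 K}} (@polyC3 K) polyC (@polyCD _) (@polyCM _) (fun=> erefl)).
Qed.

Definition ev3 (K B : comNzRingType) (phi : {rmorphism K -> B}) (a b c : B) :
  {poly {poly2 K}} -> B := horner_eval c \o map_poly (ev2 phi a b).
HB.instance Definition _ (K B : comNzRingType) (phi : {rmorphism K -> B})
    (a b c : B) := GRing.RMorphism.on (ev3 phi a b c).

Section Evaluation3.
Variables (K B : comNzRingType) (phi : {rmorphism K -> B}) (a b c : B).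

Lemma ev3_polyC f : ev3 phi a b c f%:P = ev2 phi a b f.
Proof. by rewrite /ev3 /= map_polyC /= /horner_eval hornerC. Qed.

Lemma ev3X : ev3 phi a b c 'X = c.
Proof. by rewrite /ev3 /= map_polyX /horner_eval hornerX. Qed.
End Evaluation3.

Lemma poly_ev2_sum (K : comNzRingType) n (xi : {poly {poly2 K}}) :
  (size xi <= n)%N ->
  xi = \sum_(k < n) @ev2 K {poly {poly2 K}} (@polyC3 K) 'X%:P%:P 'X%:P xi`_k * 'X ^+ k.
Proof.
move=> sxi; rewrite [LHS](_ : _ = \poly_(k < n) xi`_k).
  by rewrite poly_def; apply: eq_bigr => k _; rewrite ev2_polyC3 mul_polyC.
apply/polyP => k; rewrite coef_poly; case: ltnP => // nk.
by rewrite nth_default // (leq_trans sxi).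
Qed.

Definition frac_const (K : comNzRingType) (D : idomainType) (phi : {rmorphism K -> D}) :
  K -> {fraction {poly D}} := @FracField.tofrac {poly D} \o (polyC \o phi).
HB.instance Definition _ (K : comNzRingType) (D : idomainType)
  (phi : {rmorphism K -> D}) := GRing.RMorphism.on (frac_const phi).

Section Rescale.
Variables (K : comNzRingType) (D : idomainType) (phi : {rmorphism K -> D}).
Variables (x y T : D) (w1 w2 : nat) (R : int).
Local Notation F := (@FracField.tofrac {poly D}).

(** Supplies the [theta] that [homog] expects; the negative powers of the homogenizing variable are
    the reason for a fraction field. *)
Definition rescale : {poly {poly2 K}} -> {fraction {poly D}} :=
  @ev3 K {fraction {poly D}} (frac_const phi) (F 'X ^ (- w1%:Z) * F x%:P)
    (F 'X ^ (- w2%:Z) * F y%:P) (F 'X ^ R * F T%:P).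
HB.instance Definition _ := GRing.RMorphism.on rescale.

Lemma rescaleC c : rescale c%:P%:P%:P = F (phi c)%:P.
Proof. by rewrite [LHS]ev3_polyC [LHS]ev2C. Qed.

Lemma rescaleX : rescale 'X%:P%:P = F 'X ^ (- w1%:Z) * F x%:P.
Proof. by rewrite [LHS]ev3_polyC [LHS]ev2X. Qed.

Lemma rescaleY : rescale 'X%:P = F 'X ^ (- w2%:Z) * F y%:P.
Proof. by rewrite [LHS]ev3_polyC [LHS]ev2Y. Qed.

Lemma rescaleT : rescale 'X = F 'X ^ R * F T%:P.
Proof. by rewrite [LHS]ev3X. Qed.
End Rescale.

Section HomogRescale.
Variables (K : fieldType) (w1 w2 : nat) (R : int).
Local Notation D := {poly {poly2 K}}.
Definition rescale_std : D -> {fraction {poly D}} :=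
  @rescale K D (@polyC3 K) 'X%:P%:P 'X%:P 'X w1 w2 R.
HB.instance Definition _ := GRing.RMorphism.on rescale_std.
Local Notation homog := (@homog D rescale_std).

Lemma homog_rescaleC (c : K) : homog 0 (polyC3 c) (polyC3 c)%:P.
Proof. by apply: homog_id; rewrite oppr0 mul1r; exact: rescaleC. Qed.

Lemma homog_rescaleX : homog w1%:Z 'X%:P%:P 'X%:P%:P%:P.
Proof. by apply: homog_id; exact: rescaleX. Qed.

Lemma homog_rescaleY : homog w2%:Z 'X%:P 'X%:P%:P.
Proof. by apply: homog_id; exact: rescaleY. Qed.

Lemma homog_rescaleT : homog (- R) 'X 'X%:P.
Proof. by apply: homog_id; rewrite opprK; exact: rescaleT. Qed.
End HomogRescale.

(** The maximum of the rational slopes d/k, with denominators cleared. *)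
Lemma max_ratio (I : finType) (P : pred I) (d : I -> int) (k : I -> nat) i0 :
  P i0 -> (forall i, P i -> (0 < k i)%N) ->
  exists2 i1, P i1 & forall i, P i -> d i * (k i1)%:Z <= d i1 * (k i)%:Z.
Proof.
move=> Pi0 k0; pose q i : rat := (d i)%:~R / (k i)%:R.
have [i1 Pi1 max1] := Order.TotalTheory.arg_maxP q Pi0.
exists i1 => // i Pi; have := max1 i Pi; rewrite /q /=.
have kp j : P j -> 0 < (k j)%:R :> rat by move=> /k0; rewrite ltr0n.
rewrite ler_pdivrMr ?kp // mulrAC ler_pdivlMr ?kp //.
by rewrite -[(k i)%:R]/((k i)%:Z%:~R) -[(k i1)%:R]/((k i1)%:Z%:~R) -!intrM ler_int.
Qed.

(** Confines the monomials to a finite index type, over which [max_ratio] can pick the largest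
    slope. *)
Lemma poly3_coef_bound (K : nzRingType) (xi : {poly {poly2 K}}) :
  exists M, forall k j i, xi`_k`_j`_i != 0 -> [/\ k < M, j < M & i < M]%N.
Proof.
pose Mk k := maxn (size xi`_k) (sizeY xi`_k).
exists (maxn (size xi) (\max_(k < size xi) Mk k)) => k j i nz.
have kx : (k < size xi)%N.
  by rewrite ltnNge; apply: contraNN nz => h; rewrite (nth_default _ h) !coef0.
have jx : (j < size (xi`_k)%R)%N.
  by rewrite ltnNge; apply: contraNN nz => h; rewrite [_`_j]nth_default ?coef0.
have ix : (i < sizeY (xi`_k)%R)%N.
  apply: leq_trans (max_size_coefXY _ j).
  by rewrite ltnNge; apply: contraNN nz => h; rewrite [_`_i]nth_default.
have kM : (Mk k <= \max_(k < size xi) Mk k)%N.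
  exact: (leq_bigmax (Ordinal kx : 'I_(size xi))).
by move: kM; rewrite /Mk geq_max !leq_max => /andP[a b];
  split; apply/orP; [left|right|right] => //; apply: leq_trans (_ : _ <= _)%N; eauto.
Qed.

Lemma nonconst_coef (B : nzRingType) (p : {poly B}) :
  (1 < size p)%N -> exists2 k, (0 < k)%N & p`_k != 0.
Proof.
move=> sp; exists (size p).-1; first by rewrite -ltnS prednK // ltnW.
by rewrite -/(lead_coef p) lead_coef_eq0 -size_poly_gt0 ltnW.
Qed.

Lemma poly2_neq0_coef (K : nzRingType) (f : {poly2 K}) :
  f != 0 -> exists j i, f`_j`_i != 0.
Proof.
move=> f0; exists (size f).-1, (size (lead_coef f)).-1.
by rewrite -/(lead_coef f) -/(lead_coef (lead_coef f)) !lead_coef_eq0.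
Qed.

Section HomogeneousCoaction.
Variables (K : fieldType) (m n : nat) (xi eta : {poly {poly2 K}}).
Local Notation ev3Z := (@ev2 K {poly {poly2 K}} (@polyC3 K)).
Hypotheses (xi0 : xi`_0 = 'X%:P) (eta0 : eta`_0 = 'X).
Hypothesis nonconst : ~~ ((size xi <= 1) && (size eta <= 1))%N.

(* R / k0 is the largest slope at which a monomial with T occurs, so that giving
   T weight -R (and scaling the other weights by k0) keeps the top parts of xi
   and eta nonconstant in T. *)
Lemma best_slope : exists (k0 : nat) (R : int),
  [/\ (0 < k0)%N,
      forall k, weight_le (k0 * m) (k0 * n) ((k0 * m)%N%:Z + R * k%:Z) xi`_k,
      forall k, weight_le (k0 * m) (k0 * n) ((k0 * n)%N%:Z + R * k%:Z) eta`_k &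
      exists j i,
       (xi`_k0`_j`_i != 0 /\
         (k0 * m * i + k0 * n * j)%N%:Z = (k0 * m)%N%:Z + R * k0%:Z) \/
       (eta`_k0`_j`_i != 0 /\
         (k0 * m * i + k0 * n * j)%N%:Z = (k0 * n)%N%:Z + R * k0%:Z)].
Proof.
have [M1 HM1] := poly3_coef_bound xi; have [M2 HM2] := poly3_coef_bound eta.
pose M := maxn M1 M2; pose I := (bool * 'I_M * 'I_M * 'I_M)%type.
pose h b := if b then xi else eta; pose w b := if b then m else n.
have HM b k j i : (h b)`_k`_j`_i != 0 -> [/\ k < M, j < M & i < M]%N.
  by case: b => [/HM1|/HM2] [? ? ?]; split; rewrite leq_max; apply/orP; auto.
(* The tuple stands for the monomial X^i Y^j T^k of xi or eta. [d] is the excess of its weight over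
   the weight of X or Y respectively, so that d/k is its slope. *)
pose P (t : I) := let: (b, k, j, i) := t in (0 < k)%N && ((h b)`_k`_j`_i != 0).
pose d (t : I) := let: (b, k, j, i) := t in (m * i + n * j)%N%:Z - (w b)%:Z.
pose kk (t : I) := let: (b, k, j, i) := t in nat_of_ord k.
have [t0 Pt0] : exists t0, P t0.
  have [b hb] : exists b, (1 < size (h b))%N.
    by move: nonconst; rewrite negb_and -!ltnNge => /orP[]; [exists true|exists false].
  have [k k0 /poly2_neq0_coef[j [i nz]]] := nonconst_coef hb.
  have [kM jM iM] := HM _ _ _ _ nz.
  by exists (b, Ordinal kM, Ordinal jM, Ordinal iM); rewrite /P /= k0.
have kpos t : P t -> (0 < kk t)%N by case: t => [[[b k] j] i] /andP[].
have [[[[b1 k1] j1] i1] /andP[k1p nz1] max1] := max_ratio d Pt0 kpos.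
have bound b k : weight_le (k1 * m) (k1 * n)
    ((k1 * w b)%N%:Z + d (b1, k1, j1, i1) * k%:Z) (h b)`_k.
  move=> i j nz; have [kM jM iM] := HM _ _ _ _ nz.
  (* For k = 0 the coefficient is X or Y itself and attains the bound; for k > 0 the bound is the
     maximality of the slope. *)
  case: (posnP k) => [k0|kp].
    rewrite k0 mulr0 addr0; move: nz; rewrite k0; case: b {kM jM iM} => /=.
      rewrite xi0 coefC; case: (j =P 0%N) => [->|_]; last by rewrite coef0 eqxx.
      rewrite coefX; case: (i =P 1%N) => [->|_]; last by rewrite eqxx.
      by rewrite muln0 addn0 muln1.
    rewrite eta0 coefX; case: (j =P 1%N) => [->|_]; last by rewrite coef0 eqxx.
    rewrite coef1; case: (i =P 0%N) => [->|_]; last by rewrite eqxx.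
    by rewrite muln0 add0n muln1.
  have /= := max1 (b, Ordinal kM, Ordinal jM, Ordinal iM).
  rewrite kp nz => /(_ isT); rewrite -lerBlDl; apply: le_trans.
  rewrite le_eqVlt; apply/orP; left; apply/eqP.
  rewrite !PoszD !PoszM; ring.
exists k1, (d (b1, k1, j1, i1)); split=> //.
- exact: (bound true).
- exact: (bound false).
exists j1, i1; move: nz1; case: b1 {max1 bound} => /= nz1; [left|right]; split=> //;
  rewrite !PoszD !PoszM; ring.
Qed.

Lemma top_part (w1 w2 : nat) (R N : int) (h : {poly {poly2 K}}) :
  (forall k, weight_le w1 w2 (N + R * k%:Z) h`_k) ->
  exists2 H, @homog {poly {poly2 K}} (@rescale_std K w1 w2 R) N h H &
    forall k, (H.[0])`_k = top_form w1 w2 (N + R * k%:Z) h`_k.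
Proof.
move=> wh.
have homogP := @homog_poly K {poly {poly2 K}} (@polyC3 K)
  (@rescale_std K w1 w2 R) w1 w2 (@homog_rescaleC K w1 w2 R)
  'X%:P%:P 'X%:P 'X R (@homog_rescaleX K w1 w2 R) (@homog_rescaleY K w1 w2 R)
  (@homog_rescaleT K w1 w2 R).
have [H hH H0] := homogP N (size h) _ wh.
exists H; first by rewrite [h](poly_ev2_sum (leqnn _)).
pose q := \poly_(k < size h) top_form w1 w2 (N + R * k%:Z) h`_k.
have -> : H.[0] = q.
  rewrite H0 [RHS](@poly_ev2_sum _ (size h) q (size_poly _ _)).
  by apply: eq_bigr => k _; rewrite coef_poly ltn_ord.
move=> k; rewrite coef_poly; case: ltnP => // hk.
rewrite [h`_k]nth_default //; apply/polyP => j; apply/polyP => i.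
by rewrite coef_top_form !coef0 if_same.
Qed.

Lemma top_form_monomial w1 w2 N (f : {poly2 K}) :
  (forall j i, f`_j`_i != 0 -> (w1 * i + w2 * j)%N%:Z = N) -> top_form w1 w2 N f = f.
Proof.
move=> H; apply/polyP => j; apply/polyP => i; rewrite coef_top_form.
have [->|/H->] := eqVneq (f`_j`_i) 0; first by rewrite if_same.
by rewrite eqxx.
Qed.

Lemma size_top_part w1 w2 N (f : {poly2 K}) (h : {poly {poly2 K}}) k j i :
  (0 < k)%N -> h`_k = top_form w1 w2 N f -> f`_j`_i != 0 ->
  (w1 * i + w2 * j)%N%:Z = N -> (1 < size h)%N.
Proof.
move=> k0 hk nz wN; apply: leq_ltn_trans k0 _; rewrite ltnNge; apply/negP => sk.
by move: nz; have := coef_top_form w1 w2 N f i j;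
  rewrite wN eqxx -hk (nth_default _ sk) !coef0 => <-; rewrite eqxx.
Qed.

(** The new pair is the value at e = 0 of the homogenizations of xi and eta. Their T-free terms X
    and Y have exactly the top weight and survive, and so does a monomial with T, by the choice of
    the slope. *)
Lemma homogeneous_coaction : exists (k0 : nat) (xib etab : {poly {poly2 K}}),
  [/\ (0 < k0)%N, xib`_0 = 'X%:P, etab`_0 = 'X,
      ~~ ((size xib <= 1) && (size etab <= 1))%N &
      forall N f, weight_le (k0 * m) (k0 * n) N f -> ev3Z xi eta f = f%:P ->
        ev3Z xib etab (top_form (k0 * m) (k0 * n) N f)
        = (top_form (k0 * m) (k0 * n) N f)%:P].
Proof.
have [k0 [R [k0p wxi weta att]]] := best_slope.
have [X hX X0] := top_part wxi; have [E hE E0] := top_part weta.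
exists k0, X.[0], E.[0]; split=> //.
- rewrite X0 mulr0 addr0 xi0 top_form_monomial // => j i.
  rewrite coefC; case: (j =P 0%N) => [->|_]; last by rewrite coef0 eqxx.
  rewrite coefX; case: (i =P 1%N) => [->|_]; last by rewrite eqxx.
  by rewrite muln0 addn0 muln1.
- rewrite E0 mulr0 addr0 eta0 top_form_monomial // => j i.
  rewrite coefX; case: (j =P 1%N) => [->|_]; last by rewrite coef0 eqxx.
  rewrite coef1; case: (i =P 0%N) => [->|_]; last by rewrite eqxx.
  by rewrite muln0 add0n muln1.
- rewrite negb_and -!ltnNge; apply/orP; case: att => j [i [[nz wN]|[nz wN]]].
    by left; apply: size_top_part k0p (X0 k0) nz wN.
  by right; apply: size_top_part k0p (E0 k0) nz wN.
move=> N f wf If.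
have inv := @top_form_invariant K {poly {poly2 K}} (@polyC3 K)
  (@rescale_std K (k0 * m) (k0 * n) R) (k0 * m) (k0 * n)
  (@homog_rescaleC K _ _ R) 'X%:P%:P 'X%:P (@homog_rescaleX K _ _ R)
  (@homog_rescaleY K _ _ R).
have := inv _ _ _ _ _ _ wf hX hE.
by rewrite !ev2_polyC3 => ->.
Qed.
End HomogeneousCoaction.

(** * Lowering the degree by a shear *)

Lemma coef2_mulXY (K : comNzRingType) (q : {poly2 K}) j i :
  ('X%:P * 'X * q)`_j`_i = if (j == 0%N) || (i == 0%N) then 0 else q`_j.-1`_i.-1.
Proof.
rewrite -mulrA coefCM coefXM; case: ifP => [_|_]; first by rewrite mulr0 coef0.
by rewrite coefXM; case: ifP.
Qed.

Lemma dvd_XY (K : comNzRingType) (f : {poly2 K}) :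
  (forall j i, f`_j`_i != 0 -> (0 < i)%N && (0 < j)%N) ->
  exists q, f = 'X%:P * 'X * q.
Proof.
move=> H; exists (\poly_(j < size f) \poly_(i < sizeY f) f`_j.+1`_i.+1).
apply/polyP => j; apply/polyP => i; rewrite coef2_mulXY.
case: j => [|j] /=; first by apply/eqP; apply: contraT => /H; rewrite andbF.
case: i => [|i] /=; first by apply/eqP; apply: contraT => /H.
rewrite coef_poly; case: ltnP => sj; last by rewrite [f`_j.+1]nth_default ?coef0 // ltnW.
rewrite coef_poly; case: ltnP => si //.
by rewrite nth_default // (leq_trans (max_size_coefXY _ _)) // ltnW.
Qed.

Lemma max_weight (K : nzRingType) (w1 w2 : nat) (f : {poly2 K}) : f != 0 ->
  exists N : nat, weight_le w1 w2 N%:Z f /\ top_form w1 w2 N%:Z f != 0.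
Proof.
case/poly2_neq0_coef=> j0 [i0 nz0].
have lt2 j i : f`_j`_i != 0 -> (j < size f)%N /\ (i < sizeY f)%N.
  move=> nz; split.
    by rewrite ltnNge; apply: contraNN nz => h; rewrite [f`_j]nth_default ?coef0.
  apply: leq_trans (max_size_coefXY _ j).
  by rewrite ltnNge; apply: contraNN nz => h; rewrite nth_default.
pose P (t : 'I_(size f) * 'I_(sizeY f)) := f`_t.1`_t.2 != 0.
pose F (t : 'I_(size f) * 'I_(sizeY f)) := (w1 * t.2 + w2 * t.1)%N.
have [sj si] := lt2 _ _ nz0.
case: (@arg_maxnP _ (Ordinal sj, Ordinal si) P F nz0) => -[j1 i1] nz1 max1.
exists (F (j1, i1)); split=> [i j nz|].
  by have [sj' si'] := lt2 _ _ nz; apply: (max1 (Ordinal sj', Ordinal si') nz).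
apply/eqP => /(congr1 (fun q : {poly2 K} => q`_j1`_i1)).
by rewrite coef_top_form eqxx !coef0; apply/eqP.
Qed.

Lemma coef_degX (K : nzRingType) (f : {poly2 K}) :
  f != 0 -> exists j, f`_j`_(sizeY f).-1 != 0.
Proof.
rewrite -swapXY_eq0 sizeYE -lead_coef_eq0 /lead_coef => /eqP nz.
have {nz} : (swapXY f)`_(size (swapXY f)).-1 != 0 by apply/eqP.
rewrite -lead_coef_eq0 /lead_coef coef_swapXY => nz; by eexists; exact: nz.
Qed.

Lemma coef_degY (K : nzRingType) (f : {poly2 K}) :
  f != 0 -> exists i, f`_(size f).-1`_i != 0.
Proof.
rewrite -lead_coef_eq0 -lead_coef_eq0 {1}/lead_coef => nz.
by eexists; exact: nz.
Qed.

(** The monomials of this weight lie on the segment from X^(i0 g) to Y^(j0 g), that is, j0 i + i0 j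
    = i0 j0 g. Coprimality gives i = i0 a, and then j = j0 (g - a). *)
Lemma weight_binform (K : fieldType) (f : {poly2 K}) k0 g i0 j0 :
  (0 < k0)%N -> (0 < g)%N -> (0 < i0)%N -> (0 < j0)%N -> coprime i0 j0 ->
  top_form (k0 * (j0 * g)) (k0 * (i0 * g)) (k0 * (i0 * g * (j0 * g)))%N%:Z f =
  binform (@polyC2 K \o (fun a => f`_(j0 * (g - a))`_(i0 * a))) g ('X%:P ^+ i0) ('X ^+ j0).
Proof.
move=> k0p gp i0p j0p cop.
apply/polyP => j; apply/polyP => i; rewrite coef_top_form eqz_nat.
have coefT a : ((@polyC2 K \o (fun a => f`_(j0 * (g - a))`_(i0 * a))) a
    * 'X%:P ^+ i0 ^+ a * 'X ^+ j0 ^+ (g - a))`_j`_i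
  = if (i == i0 * a)%N && (j == j0 * (g - a))%N then f`_j`_i else 0.
  rewrite -!exprM -rmorphXn -mulrA /= coefCM coefCM coefCM coefXn.
  case: eqP => [->|_]; last by rewrite andbF !mulr0 coef0 mulr0.
  rewrite mulr1 andbT coefXn; case: eqP => [->|_]; by rewrite ?mulr1 ?mulr0.
rewrite /binform coef_sum coef_sum; under eq_bigr => a _ do rewrite coefT.
have -> : ((k0 * (j0 * g) * i + k0 * (i0 * g) * j)%N == (k0 * (i0 * g * (j0 * g)))%N)
     = (j0 * i + i0 * j == i0 * (j0 * g))%N.
  rewrite -[RHS](eqn_pmul2l (m := k0 * g)%N) ?muln_gt0 ?k0p //; congr (_ == _); ring.
case: eqP => E; last first.
  rewrite big1 // => a _; case: ifP => // /andP[/eqP ei /eqP ej]; case: E.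
  by rewrite ei ej mulnCA -!mulnDr subnKC // -ltnS.
have di : (i0 %| i)%N.
  rewrite -(Gauss_dvdr i cop) -(dvdn_addl _ (dvdn_mulr j (dvdnn i0))) E.
  exact: dvdn_mulr.
have [a ea] := dvdnP di; rewrite mulnC in ea.
have ej : (j0 * a + j = j0 * g)%N.
  apply/eqP; rewrite -(eqn_pmul2l i0p) mulnDr -E ea; apply/eqP; ring.
have ag : (a <= g)%N by rewrite -(leq_pmul2l j0p) -ej leq_addr.
rewrite (bigD1 (Ordinal (ag : (a < g.+1)%N))) //= ea eqxx.
rewrite mulnBr -ej addKn eqxx big1 ?addr0 //= => b nb.
case: ifP => // /andP[/eqP eb _]; case/eqP: nb; apply/val_inj => /=.
by apply/eqP; rewrite -(eqn_pmul2l i0p) eb.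
Qed.

Section ShearDegree.
Variables (K : fieldType) (f : {poly2 K}) (dx j0 : nat) (r : K).
Hypotheses (j0p : (0 < j0)%N) (szY : (sizeY f <= dx.+1)%N).
Hypothesis wt : forall j i, f`_j`_i != 0 -> (j0 * i + j <= j0 * dx)%N.
Let s : {poly2 K} := 'X%:P + r%:P%:P * 'X ^+ j0.
Let f1 := @ev2 K {poly2 K} (@polyC2 K) s 'X f.

Let szf : (size f <= (j0 * dx).+1)%N.
Proof.
apply/leq_sizeP => j hj; apply/polyP => i; rewrite coef0; apply/eqP.
by apply: contraTT hj => /wt; rewrite -leqNgt => h; apply: leq_trans h; apply: leq_addl.
Qed.

Let f1E : f1 = \sum_(j < (j0 * dx).+1) \sum_(i < dx.+1) polyC2 f`_j`_i * s ^+ i * 'X ^+ j.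
Proof. exact: ev2E. Qed.

Let size_s : (size s <= j0.+1)%N.
Proof.
apply: leq_trans (size_polyD _ _) _; rewrite geq_max.
rewrite (leq_trans (size_polyC_leq1 _)) //= mul_polyC.
by apply: leq_trans (size_scale_leq _ _) _; rewrite size_polyXn.
Qed.

Let coef_s : s`_j0 = r%:P.
Proof.
by rewrite coefD coefC coefCM coefXn eqxx mulr1 -[j0 == 0%N]negbK -lt0n j0p add0r.
Qed.

(** As a polynomial in X, s has degree 1, so substituting it for X cannot raise the degree in X.
    [swapXY] makes X the outer variable, whose degree [size] measures. *)
Lemma shear_sizeY : (sizeY f1 <= dx.+1)%N.
Proof.
have sws : swapXY s = 'X + (r%:P * 'X^j0)%:P.
  rewrite rmorphD rmorphM rmorphXn /= swapXY_X !swapXY_polyC map_polyX map_polyC /=.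
  by rewrite -rmorphXn -polyCM.
have E : swapXY f1 = \sum_(j < (j0 * dx).+1) \sum_(i < dx.+1)
    (f`_j`_i)%:P%:P * (('X ^+ j)%:P * swapXY s ^+ i).
  rewrite f1E rmorph_sum; apply: eq_bigr => j _; rewrite rmorph_sum.
  apply: eq_bigr => i _.
  rewrite !rmorphM !rmorphXn /= swapXY_X swapXY_polyC map_polyC /= -rmorphXn.
  by rewrite -mulrA; congr (_ * _); rewrite mulrC.
have sX : (size (swapXY s) <= 2)%N.
  rewrite sws (leq_trans (size_polyD _ _)) // geq_max size_polyX /=.
  by rewrite (leq_trans (size_polyC_leq1 _)).
rewrite sizeYE E; apply: (leq_trans (size_sum _ _ _)); apply/bigmax_leqP => j _.
apply: (leq_trans (size_sum _ _ _)); apply/bigmax_leqP => i _.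
rewrite !mul_polyC; apply: leq_trans (size_scale_leq _ _) _.
apply: leq_trans (size_scale_leq _ _) _.
apply: leq_trans (size_exp_le i sX) _; rewrite mul1n; exact: ltn_ord.
Qed.

(** A monomial X^i Y^j contributes degree at most j0 i + j in Y, so the coefficient of Y^(j0 dx)
    comes from the top weight only. It is the form evaluated at (r, 1), which vanishes. *)
Lemma shear_size :
  binform (fun a => f`_(j0 * (dx - a))`_a) dx r 1 = 0 -> (size f1 <= j0 * dx)%N.
Proof.
move=> root.
have szT j i : (size (s ^+ i * 'X ^+ j)%R <= (j0 * i + j).+1)%N.
  by apply: size_mul_le; [exact: size_exp_le | rewrite size_polyXn].
have szf1 : (size f1 <= (j0 * dx).+1)%N.
  rewrite f1E; apply: (leq_trans (size_sum _ _ _)); apply/bigmax_leqP => j _.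
  apply: (leq_trans (size_sum _ _ _)); apply/bigmax_leqP => i _.
  have [->|nz] := eqVneq (f`_j`_i) 0; first by rewrite rmorph0 !mul0r size_poly0.
  rewrite -mulrA mul_polyC; apply: leq_trans (size_scale_leq _ _) _.
  by apply: leq_trans (szT _ _) _; rewrite ltnS wt.
apply/leq_sizeP => k; rewrite leq_eqVlt => /orP[/eqP <-|hk]; last first.
  by rewrite nth_default // (leq_trans szf1).
have coefT j i : (polyC2 f`_j`_i * s ^+ i * 'X ^+ j)`_(j0 * dx)
   = if (j0 * i + j == j0 * dx)%N then (f`_j`_i * r ^+ i)%:P else 0.
  have [->|nz] := eqVneq (f`_j`_i) 0.
    by rewrite rmorph0 !mul0r coef0 polyC0 if_same.
  rewrite -mulrA coefCM; case: eqP => [e|/eqP ne].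
    rewrite -e (coef_mul_top (size_exp_le i size_s)) ?size_polyXn //.
    by rewrite (coef_exp_top _ size_s) coef_s coefXn eqxx mulr1 -rmorphXn -polyCM.
  rewrite [(s ^+ i * _)`_ _]nth_default ?mulr0 //; apply: leq_trans (szT _ _) _.
  by rewrite ltn_neqAle ne wt.
rewrite f1E coef_sum; under eq_bigr => j _ do
  (rewrite coef_sum; under eq_bigr => i _ do rewrite coefT).
rewrite exchange_big /=.
apply: (@etrans _ _ (binform (fun a => f`_(j0 * (dx - a))`_a) dx r 1)%:P); last first.
  by rewrite root.
rewrite rmorph_sum; apply: eq_bigr => i _ /=.
have hi : (j0 * i <= j0 * dx)%N by rewrite leq_mul2l -ltnS ltn_ord orbT.
have hb : (j0 * (dx - i) < (j0 * dx).+1)%N by rewrite ltnS leq_mul2l leq_subr orbT.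
have ee : (j0 * i + j0 * (dx - i) == j0 * dx)%N.
  by rewrite -mulnDr subnKC // -ltnS ltn_ord.
rewrite (bigD1 (Ordinal hb)) //= ee expr1n mulr1 big1 ?addr0 //.
move=> j nj; case: eqP => // e; case/eqP: nj; apply/val_inj => /=.
by apply/eqP; rewrite -(eqn_add2l (j0 * i)) (eqP ee); exact/eqP.
Qed.
End ShearDegree.

Lemma shear_reduction (K : fieldType) (f : {poly2 K}) (xi eta : {poly {poly2 K}}) :
  xi`_0 = 'X%:P -> eta`_0 = 'X -> ~~ ((size xi <= 1) && (size eta <= 1))%N ->
  @ev2 K {poly {poly2 K}} (@polyC3 K) xi eta f = f%:P ->
  (1 < sizeY f)%N -> (sizeY f <= size f)%N ->
  exists (r : K) (j : nat),
   let f1 := @ev2 K {poly2 K} (@polyC2 K) ('X%:P + r%:P%:P * 'X ^+ j) 'X f in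
   (size f1 < size f)%N /\ (sizeY f1 <= sizeY f)%N.
Proof.
move=> xi0 eta0 nonconst If sY1 sYX.
pose dx := (sizeY f).-1; pose dy := (size f).-1.
have f0 : f != 0 by rewrite -sizeY_eq0 -lt0n ltnW.
have sxE : sizeY f = dx.+1 by rewrite prednK // ltnW.
have syE : size f = dy.+1 by rewrite prednK // (leq_trans _ sYX) // ltnW.
have dxp : (0 < dx)%N by rewrite -ltnS -sxE.
have dxy : (dx <= dy)%N by rewrite -ltnS -sxE -syE.
have dyp : (0 < dy)%N := leq_trans dxp dxy.
(* With weight dy for X and dx for Y, up to the factor k0, the powers X^dx and Y^dy weigh the
   same. *)
have [k0 [xib [etab [k0p xib0 etab0 ncb inv]]]] := homogeneous_coaction dy dx xi0 eta0 nonconst.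
have [N [wN topN0]] := max_weight (k0 * dy) (k0 * dx) f0.
have {inv} hfb := inv _ _ wN If.
pose h : {rmorphism {poly2 K} -> {poly {poly2 K}}} :=
  @ev2 K {poly {poly2 K}} (@polyC3 K) xib etab.
have {hfb} : h (top_form (k0 * dy) (k0 * dx) N%:Z f) = (top_form (k0 * dy) (k0 * dx) N%:Z f)%:P.
  exact: hfb.
have hC (a : K) : h a%:P%:P = a%:P%:P%:P by apply: etrans (ev2C _ _ _ _) _.
have hX : h 'X%:P = xib by apply: etrans (ev2X _ _ _) _.
have hY : h 'X = etab by apply: etrans (ev2Y _ _ _) _.
move: h hC hX hY => h hC hX hY hfb.
have h0 u : (h u)`_0 = u.
  apply: (poly2_hom_ext (h1 := fun u => (h u)`_0) (h2 := id)) => //.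
  - by move=> u1 u2; rewrite rmorphD coefD.
  - by move=> u1 u2; rewrite rmorphM coef0M.
  - by move=> c; rewrite hC coefC.
  - by rewrite hX.
  by rewrite hY.
have hnc : ~~ ((size (h 'X%:P) <= 1) && (size (h 'X) <= 1))%N by rewrite hX hY.
have deg j i : f`_j`_i != 0 -> (i <= dx)%N /\ (j <= dy)%N.
  move=> nz; rewrite -(ltnS i) -(ltnS j) -sxE -syE; split.
    apply: leq_trans (max_size_coefXY _ j).
    by rewrite ltnNge; apply: contraNN nz => hs; rewrite nth_default.
  by rewrite ltnNge; apply: contraNN nz => hs; rewrite [f`_j]nth_default ?coef0.
(* A pure power of X or Y in f weighs at most k0 dx dy. A larger top weight would thus make the
   fixed top form divisible by XY. *)
have Nle : (N <= k0 * (dx * dy))%N.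
  rewrite leqNgt; apply/negP => Ngt.
  have [|q fbE] := @dvd_XY K (top_form (k0 * dy) (k0 * dx) N%:Z f).
    move=> j i; rewrite coef_top_form eqz_nat.
    case: (_ =P N) => [wE nz|_]; last by rewrite eqxx.
    have [idx jdy] := deg _ _ nz; move: Ngt; rewrite -wE.
    case: i idx {nz wE} => [|i] idx; last case: j jdy => [|j] jdy //.
      by rewrite muln0 add0n ltnNge -mulnA leq_pmul2l // leq_pmul2l // jdy.
    by rewrite muln0 addn0 ltnNge [(dx * dy)%N]mulnC -mulnA leq_pmul2l // leq_pmul2l // idx.
  rewrite fbE in topN0 hfb; exact: (coaction_mulXY h0 hnc topN0 hfb).
(* Monomials X^dx Y^jx and X^iy Y^dy occur in f. The bound on the weight forces jx = iy = 0, so both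
   pure powers occur and give the nonzero end coefficients of the form. *)
have [jx nzx] := coef_degX f0; rewrite sxE /= in nzx.
have [iy nzy] := coef_degY f0; rewrite syE /= in nzy.
have := wN _ _ nzx; have := wN _ _ nzy; rewrite !lez_nat => le1 le2.
have NE : N = (k0 * (dx * dy))%N.
  apply/eqP; rewrite eqn_leq Nle (leq_trans _ le2) //.
  by rewrite [(dx * dy)%N]mulnC mulnA leq_addr.
have jx0 : jx = 0%N.
  move: le2; rewrite NE [(dx * dy)%N]mulnC mulnA -[leqRHS]addn0 leq_add2l leqn0.
  by rewrite !muln_eq0 (gtn_eqF k0p) (gtn_eqF dxp) => /eqP.
have iy0 : iy = 0%N.
  move: le1; rewrite NE mulnA -[leqRHS]add0n leq_add2r leqn0.
  by rewrite !muln_eq0 (gtn_eqF k0p) (gtn_eqF dyp) => /eqP.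
subst jx iy N.
pose g := gcdn dx dy; have gp : (0 < g)%N by rewrite gcdn_gt0 dxp.
have [i0 dxE] := dvdnP (dvdn_gcdl dx dy); have [j0 dyE] := dvdnP (dvdn_gcdr dx dy).
rewrite -/g in dxE dyE.
have i0p : (0 < i0)%N by move: dxp; rewrite dxE muln_gt0 => /andP[].
have j0p : (0 < j0)%N by move: dyp; rewrite dyE muln_gt0 => /andP[].
have cop : coprime i0 j0.
  by rewrite /coprime -(eqn_pmul2r gp) muln_gcdl -dxE -dyE mul1n.
rewrite dxE dyE (weight_binform _ k0p gp i0p j0p cop) in hfb topN0.
have [||[r root] ij1] := coaction_binform h0 hC hnc i0p j0p cop gp _ _ topN0 hfb.
- by rewrite subn0 muln0 -dyE.
- by rewrite subnn muln0 -dxE.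
(* If j0 = 1, then dy = g, and dx = i0 g <= dy gives i0 = 1 as well. *)
have i01 : i0 = 1%N.
  apply/eqP; case/orP: ij1 => // /eqP j01; rewrite eqn_leq i0p andbT.
  by rewrite -(leq_pmul2r gp) -dxE (leq_trans dxy) // dyE j01.
have gE : g = dx by rewrite dxE i01 mul1n.
rewrite gE in dyE; rewrite gE i01 in root.
have wt j i : f`_j`_i != 0 -> (j0 * i + j <= j0 * dx)%N.
  move=> nz; have := wN i j nz; rewrite lez_nat dyE.
  rewrite -[(j0 * i + j <= _)%N](leq_pmul2l (m := k0 * dx)) ?muln_gt0 ?k0p //.
  by congr (_ <= _)%N; ring.
have szY : (sizeY f <= dx.+1)%N by rewrite sxE.
exists r, j0 => f1; split.
  rewrite syE dyE ltnS; apply: (shear_size j0p szY wt).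
  by rewrite -[RHS]root; apply: eq_bigr => a _; rewrite mul1n.
rewrite sxE; exact: (shear_sizeY r szY wt).
Qed.

(** * The Weyl algebra *)

Section OrderedEvaluation.
Variables (K : fieldType) (A : algType K).
Implicit Types (u v : A) (q : {poly K}) (f : {poly2 K}).

(* Substitution of u for X and v for Y with the powers of u on the left; u and v
   need not commute. *)
Definition wev u v f : A := (map_poly (horner_alg u) f).[v].

Lemma wevD u v f g : wev u v (f + g) = wev u v f + wev u v g.
Proof. by rewrite /wev rmorphD hornerD. Qed.

Lemma wev0 u v : wev u v 0 = 0.
Proof. by rewrite /wev rmorph0 horner0. Qed.

Lemma wevB u v f g : wev u v (f - g) = wev u v f - wev u v g.
Proof. by rewrite /wev rmorphB hornerD hornerN. Qed.

Lemma wev_polyC u v q : wev u v q%:P = horner_alg u q.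
Proof. by rewrite /wev map_polyC hornerC. Qed.

Lemma wevC u v c : wev u v c%:P%:P = c%:A.
Proof. by rewrite wev_polyC horner_algC. Qed.

Lemma wevX u v : wev u v 'X%:P = u.
Proof. by rewrite wev_polyC horner_algX. Qed.

Lemma wevY u v : wev u v 'X = v.
Proof. by rewrite /wev map_polyX hornerX. Qed.

Lemma wevCM u v q f : wev u v (q%:P * f) = horner_alg u q * wev u v f.
Proof. by rewrite /wev rmorphM /= map_polyC /= hornerCM. Qed.

Lemma wevMX u v f : wev u v (f * 'X) = wev u v f * v.
Proof. by rewrite /wev rmorphM /= map_polyX hornerMX. Qed.

Lemma wevZ u v c f : wev u v (c%:P%:P * f) = c *: wev u v f.
Proof. by rewrite wevCM horner_algC mulr_algl. Qed.

Lemma wev_XM u v f : wev u v ('X%:P * f) = u * wev u v f.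
Proof. by rewrite wevCM horner_algX. Qed.

Lemma horner_algE u q n : (size q <= n)%N ->
  horner_alg u q = \sum_(i < n) q`_i *: u ^+ i.
Proof.
move=> qn; rewrite /horner_alg /= /horner_morph (horner_coef_wide (n := n)); last first.
  exact: leq_trans (size_poly _ _) qn.
by apply: eq_bigr => i _; rewrite coef_map /= mulr_algl.
Qed.

Lemma wevE u v f n m : (size f <= n)%N -> (sizeY f <= m)%N ->
  wev u v f = \sum_(j < n) \sum_(i < m) f`_j`_i *: (u ^+ i * v ^+ j).
Proof.
move=> fn fm; rewrite /wev (horner_coef_wide (n := n)); last first.
  exact: leq_trans (size_poly _ _) fn.
apply: eq_bigr => j _; rewrite coef_map /= (@horner_algE _ _ m); last first.
  exact: leq_trans (max_size_coefXY _ _) fm.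
by rewrite mulr_suml; apply: eq_bigr => i _; rewrite scalerAl.
Qed.

Definition Kalg_hom (s : A -> A) : Prop :=
  [/\ forall (a : K) (u v : A), s (a *: u + v) = a *: s u + s v,
      forall u v : A, s (u * v) = s u * s v & s 1 = 1].

Section Hom.
Variable s : A -> A.
Hypothesis hs : Kalg_hom s.

Lemma Kalg_homD u v : s (u + v) = s u + s v.
Proof. by case: hs => lin _ _; have := lin 1 u v; rewrite !scale1r. Qed.

Lemma Kalg_hom0 : s 0 = 0.
Proof. by apply: (addrI (s 0)); rewrite -Kalg_homD !addr0. Qed.

Lemma Kalg_homZ c u : s (c *: u) = c *: s u.
Proof. by case: hs => lin _ _; have := lin c u 0; rewrite Kalg_hom0 !addr0. Qed.

Lemma Kalg_homB u v : s (u - v) = s u - s v.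
Proof. by rewrite Kalg_homD -scaleN1r Kalg_homZ scaleN1r. Qed.

Lemma Kalg_homM u v : s (u * v) = s u * s v.
Proof. by case: hs. Qed.

Lemma Kalg_homX u n : s (u ^+ n) = s u ^+ n.
Proof. by case: hs => _ sM s1; elim: n => [|n IHn]; rewrite ?expr0 // !exprS sM IHn. Qed.

Lemma Kalg_hom_horner u q : s (horner_alg u q) = horner_alg (s u) q.
Proof.
case: hs => _ sM s1; elim/poly_ind: q => [|q c IHq]; first by rewrite !rmorph0 Kalg_hom0.
rewrite !rmorphD !rmorphM /= !horner_algC !horner_algX.
by rewrite Kalg_homD sM IHq Kalg_homZ s1.
Qed.

Lemma Kalg_hom_wev u v f : s (wev u v f) = wev (s u) (s v) f.
Proof.
elim/poly_ind: f => [|f q IHf]; first by rewrite !wev0 Kalg_hom0.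
by rewrite !wevD !wevMX !wev_polyC Kalg_homD Kalg_homM IHf Kalg_hom_horner.
Qed.
End Hom.

Lemma comm_horner_alg a u q : a * u = u * a ->
  a * horner_alg u q = horner_alg u q * a.
Proof.
move=> au; elim/poly_ind: q => [|q c IHq]; first by rewrite rmorph0 mul0r mulr0.
rewrite rmorphD rmorphM /= horner_algC horner_algX mulrDl mulrDr.
by congr (_ + _); [rewrite mulrA IHq -!mulrA au | rewrite mulr_algl mulr_algr].
Qed.

Lemma central_wevM u v f g : (forall a, v * a = a * v) ->
  wev u v (f * g) = wev u v f * wev u v g.
Proof.
move=> cv; elim/poly_ind: f => [|f q IHf]; first by rewrite mul0r !wev0 mul0r.
rewrite mulrDl !wevD mulrDl wevCM wev_polyC mulrAC !wevMX IHf -!mulrA; congr (_ * _ + _).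
by rewrite cv.
Qed.

Section WeylPair.
Variables (u v : A).
Hypothesis uv : v * u - u * v = 1.

Let vuE : v * u = u * v + 1.
Proof. by rewrite -uv addrC subrK. Qed.

Lemma weyl_horner q : v * horner_alg u q = horner_alg u q * v + horner_alg u q^`().
Proof.
elim/poly_ind: q => [|q c IHq]; first by rewrite deriv0 !rmorph0 mul0r mulr0 addr0.
rewrite derivD derivM derivX derivC !rmorphD !rmorphM /= !rmorph0 !rmorph1.
rewrite horner_algC horner_algX mulr1 addr0 mulrDr mulrDl mulrA IHq mulrDl.
rewrite -!mulrA vuE mulrDr mulr1 mulr_algl mulr_algr.
by rewrite -!addrA; congr (_ + _); rewrite [RHS]addrC -[RHS]addrA [LHS]addrCA.
Qed.

(** On ordered polynomials, left multiplication by v is the operator dX plus multiplication by Y.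
    Depending only on the relation v u - u v = 1, this is the same operator for every such pair. *)
Lemma weyl_wev_l f : v * wev u v f = wev u v (dX f + f * 'X).
Proof.
have dd := derivation_dX K.
elim/poly_ind: f => [|f q IHf].
  by rewrite derivation0 // mul0r addr0 wev0 mulr0.
rewrite dd.1 dd.2 dX_Y mulr0 addr0 dX_polyC !wevD mulrDl !wevD !wevMX !wev_polyC.
rewrite mulrDr mulrA IHf wevD wevMX mulrDl weyl_horner.
by rewrite -!addrA; congr (_ + _); rewrite [RHS]addrC -[RHS]addrA.
Qed.

Lemma weyl_wev_r f : wev u v f * u = wev u v (dY f + 'X%:P * f).
Proof.
have dd := derivation_dY K.
elim/poly_ind: f => [|f q IHf].
  by rewrite derivation0 // mulr0 addr0 wev0 mul0r.
rewrite dd.1 dd.2 dY_Y mulr1 /dY derivC addr0 -/(dY f).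
rewrite mulrDr mulrA !wevD !wevMX -polyCM !wev_polyC mulrDl -mulrA vuE mulrDr mulr1.
rewrite mulrA IHf wevD mulrDl rmorphM /= horner_algX.
rewrite -!addrA; congr (_ + _).
have -> : horner_alg u q * u = u * horner_alg u q.
  have := rmorphM (horner_alg u) q 'X; rewrite /= horner_algX => <-.
  by rewrite mulrC rmorphM /= horner_algX.
by rewrite addrCA.
Qed.
End WeylPair.
End OrderedEvaluation.

(** This is f(X^p, Y^p): the ordered coordinates of the image of f in the centre. *)
Definition expand (K : fieldType) (p : nat) (f : {poly2 K}) : {poly2 K} :=
  map_poly (comp_poly 'X^p) f \Po 'X^p.

Section Expand.
Variables (K : fieldType) (p : nat).
Hypothesis p0 : (0 < p)%N.

Lemma coef_expand (f : {poly2 K}) j i :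
  (expand p f)`_j`_i = if (p %| j)%N && (p %| i)%N then f`_(j %/ p)`_(i %/ p) else 0.
Proof.
rewrite coef_comp_poly_Xn //; case: ifP => _ /=; last by rewrite coef0.
by rewrite coef_map /= coef_comp_poly_Xn.
Qed.

Lemma expand_inj (f g : {poly2 K}) : expand p f = expand p g -> f = g.
Proof.
move=> E; apply/polyP => j; apply/polyP => i.
have := congr1 (fun h : {poly2 K} => h`_(p * j)`_(p * i)) E.
by rewrite !coef_expand !dvdn_mulr // !mulKn.
Qed.

Lemma expand_surj (f : {poly2 K}) :
  (forall j i, f`_j`_i != 0 -> (p %| j)%N && (p %| i)%N) -> exists g, f = expand p g.
Proof.
move=> H; exists (\poly_(j < size f) \poly_(i < sizeY f) f`_(p * j)`_(p * i)).
apply/polyP => j; apply/polyP => i; rewrite coef_expand; case: ifP => [/andP[pj pi]|np].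
  have [j' ->] := dvdnP pj; have [i' ->] := dvdnP pi; rewrite !mulnK // ![(_ * p)%N]mulnC.
  rewrite coef_poly; case: ltnP => sj; last first.
    by rewrite coef0 [f`_ _]nth_default ?coef0 // (leq_trans sj) // leq_pmull.
  rewrite coef_poly; case: ltnP => si //.
  rewrite nth_default // (leq_trans (max_size_coefXY _ _)) // (leq_trans si) //.
  exact: leq_pmull.
by apply/eqP; move/negbT: np; apply: contraNT => /H.
Qed.

Lemma wev_expand (A : algType K) (u v : A) f :
  wev u v (expand p f) = wev (u ^+ p) (v ^+ p) f.
Proof.
elim/poly_ind: f => [|f q IHf]; first by rewrite /expand rmorph0 comp_poly0 !wev0.
have MXn (h : {poly2 K}) n : wev u v (h * 'X^n) = wev u v h * v ^+ n.
  by elim: n => [|n IHn]; rewrite ?expr0 ?mulr1 // !exprSr !mulrA wevMX IHn.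
rewrite /expand rmorphD rmorphM /= map_polyX map_polyC /= comp_polyD comp_polyM.
rewrite comp_polyX comp_polyC !wevD wevMX !wev_polyC MXn [wev u v _]IHf; congr (_ + _).
elim/poly_ind: q => [|q c IHq]; first by rewrite comp_poly0 !rmorph0.
rewrite comp_polyD comp_polyM comp_polyX comp_polyC !rmorphD !rmorphM /= !horner_algC.
by rewrite IHq !rmorphXn /= !horner_algX.
Qed.
End Expand.

Section Weyl.
Variables (K : fieldType) (A : algType K) (x d : A).
Hypothesis hW : is_weyl1 x d.
Local Notation wemb := (wev x d).

Let dx : d * x - x * d = 1. Proof. by case: hW. Qed.

Lemma wemb_inj : injective wemb.
Proof.
have inj0 f : wemb f = 0 -> f = 0.
  pose n := maxn (size f) (sizeY f).
  rewrite (@wevE _ _ _ _ _ n n) ?leq_maxl ?leq_maxr // exchange_big /= => E.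
  case: hW => _ _ free; have {E} := free n (fun i j => f`_j`_i) E => E.
  apply/polyP => j; apply/polyP => i; rewrite !coef0.
  case: (ltnP j n) => hj; last first.
    by rewrite [f`_j]nth_default ?coef0 // (leq_trans (leq_maxl _ _) hj).
  case: (ltnP i n) => hi; first exact: E.
  rewrite nth_default // (leq_trans (max_size_coefXY _ _)) //.
  by rewrite (leq_trans (leq_maxr _ _) hi).
by move=> f g E; apply/eqP; rewrite -subr_eq0 (inj0 (f - g)) // wevB E subrr.
Qed.

(** Boolean equality, so that coordinates can be picked by [xchoose]. *)
Lemma wemb_surj a : exists f, a == wemb f.
Proof.
case: hW => _ span _; have [n [c ->]] := span a.
exists (\poly_(j < n) \poly_(i < n) c i j); apply/eqP.
rewrite (@wevE _ _ _ _ _ n n) ?size_poly //; last first.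
  apply/bigmax_leqP => j _; rewrite coef_poly; case: ifP => _; last by rewrite size_poly0.
  exact: size_poly.
rewrite exchange_big /=; apply: eq_bigr => i _; apply: eq_bigr => j _.
by rewrite !coef_poly ltn_ord coef_poly ltn_ord.
Qed.

Definition wcoord a : {poly2 K} := xchoose (wemb_surj a).

Lemma wcoordK a : wemb (wcoord a) = a.
Proof. exact/esym/eqP/(xchooseP (wemb_surj a)). Qed.

Lemma wembK f : wcoord (wemb f) = f.
Proof. by apply: wemb_inj; rewrite wcoordK. Qed.

Lemma comm_d f : d * wemb f - wemb f * d = wemb (dX f).
Proof. by rewrite weyl_wev_l // wevD wevMX addrK. Qed.

Lemma comm_x f : wemb f * x - x * wemb f = wemb (dY f).
Proof. by rewrite weyl_wev_r // wevD wev_XM addrK. Qed.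

(** Commutators with d and with x act on coordinates as [dX] and [dY], and x and d generate the
    algebra. *)
Lemma central_wembP f : (forall b, wemb f * b = b * wemb f) <-> dX f = 0 /\ dY f = 0.
Proof.
split=> [cf | [fX fY]].
  by split; apply: wemb_inj; rewrite wev0 -?comm_d -?comm_x cf subrr.
have cd : wemb f * d = d * wemb f.
  by apply/eqP; rewrite eq_sym -subr_eq0 comm_d fX wev0.
have cx : wemb f * x = x * wemb f.
  by apply/eqP; rewrite -subr_eq0 comm_x fY wev0.
move=> b; rewrite -(wcoordK b); elim/poly_ind: (wcoord b) => [|g q IHg].
  by rewrite wev0 mul0r mulr0.
rewrite wevD wevMX wev_polyC mulrDl mulrDr comm_horner_alg //; congr (_ + _).
by rewrite mulrA IHg -!mulrA cd.
Qed.

(** The universal property of the Weyl algebra. The map defined on coordinates turns left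
    multiplication by x and d into that by u and v, since [weyl_wev_l] holds for both pairs;
    multiplicativity follows by induction on the left factor. *)
Lemma endo_exists u v : v * u - u * v = 1 ->
  exists s, [/\ Kalg_hom s, s x = u & s d = v].
Proof.
move=> uv; pose s a := wev u v (wcoord a).
have sE f : s (wemb f) = wev u v f by rewrite /s wembK.
exists s; split; [|by rewrite -(wevX x d) sE wevX|by rewrite -(wevY x d) sE wevY].
have s0 : s 0 = 0 by have := sE 0; rewrite !wev0.
have s1 : s 1 = 1 by have := sE 1%:P; rewrite !wev_polyC !rmorph1.
have sx b : s (x * b) = u * s b by rewrite -(wcoordK b) -wev_XM !sE wev_XM.
have sd b : s (d * b) = v * s b.
  by rewrite -(wcoordK b) (weyl_wev_l dx) !sE (weyl_wev_l uv).
have slin a b c : s (a *: b + c) = a *: s b + s c.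
  by rewrite -(wcoordK b) -(wcoordK c) -wevZ -wevD !sE wevD wevZ.
have sD b c : s (b + c) = s b + s c by have := slin 1 b c; rewrite !scale1r.
have sq q b : s (horner_alg x q * b) = horner_alg u q * s b.
  elim/poly_ind: q b => [|q c IHq] b.
    by rewrite !rmorph0 !mul0r s0.
  rewrite !rmorphD !rmorphM /= !horner_algC !horner_algX !mulrDl sD -mulrA IHq sx mulrA.
  by congr (_ + _); rewrite !mulr_algl -[c *: b]addr0 slin s0 addr0.
split=> // a b.
rewrite -(wcoordK a) sE; elim/poly_ind: (wcoord a) b => [|g q IHg] b.
  by rewrite !wev0 !mul0r s0.
by rewrite !wevD !wevMX !wev_polyC !mulrDl sD sq -mulrA IHg sd mulrA.
Qed.

Lemma hom_ext s1 s2 : Kalg_hom s1 -> Kalg_hom s2 -> s1 x = s2 x -> s1 d = s2 d -> s1 =1 s2.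
Proof.
by move=> h1 h2 ex ed a; rewrite -(wcoordK a) (Kalg_hom_wev h1) (Kalg_hom_wev h2) ex ed.
Qed.

Lemma Kalg_hom_comp s1 s2 : @Kalg_hom K A s1 -> Kalg_hom s2 -> Kalg_hom (s1 \o s2).
Proof.
by move=> [l1 m1 o1] [l2 m2 o2]; split=> [a u v|u v|] /=; rewrite ?l2 ?m2 ?o2.
Qed.

Lemma Kalg_hom_id : @Kalg_hom K A id.
Proof. by split. Qed.

Lemma aut_of_inverse s1 s2 : Kalg_hom s1 -> Kalg_hom s2 ->
  s2 (s1 x) = x -> s2 (s1 d) = d -> s1 (s2 x) = x -> s1 (s2 d) = d -> Kalg_aut s1.
Proof.
move=> h1 h2 e1 e2 e3 e4; case: (h1) => l m o; split=> //; exists s2.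
  exact: (hom_ext (Kalg_hom_comp h2 h1) Kalg_hom_id).
exact: (hom_ext (Kalg_hom_comp h1 h2) Kalg_hom_id).
Qed.

(** Moving d past a polynomial in x only adds terms of lower order in d. The induction passes one d
    from the left factor to the right one, turning g into L of the same leading coefficient and one
    order higher. *)
Lemma weyl_mul_lead f g : f != 0 -> g != 0 ->
  exists h, [/\ wemb f * wemb g = wemb h, size h = (size f + size g).-1 &
                lead_coef h = lead_coef f * lead_coef g].
Proof.
elim/poly_ind: f g => [|f q IHf] g; first by rewrite eqxx.
have [->|f0] := eqVneq f 0.
  rewrite mul0r add0r polyC_eq0 => q0 g0; exists (q%:P * g); rewrite wevCM wev_polyC.
  by rewrite size_mul ?lead_coefM ?polyC_eq0.
move=> fq0 g0; pose L := dX g + g * 'X.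
have sg : (0 < size g)%N by rewrite size_poly_gt0.
have sL1 : (size (dX g) < size (g * 'X)%R)%N.
  by rewrite size_mulX // ltnS; exact: size_poly.
have sL : size L = (size g).+1 by rewrite /L addrC size_polyDl // size_mulX.
have lL : lead_coef L = lead_coef g by rewrite /L addrC lead_coefDl // lead_coefMX.
have L0 : L != 0 by rewrite -size_poly_gt0 sL.
have [h [hE hs hl]] := IHf L f0 L0.
have sf : (0 < size f)%N by rewrite size_poly_gt0.
have sh : size h = (size f + size g)%N by rewrite hs sL addnS.
have sfq : size (f * 'X + q%:P) = (size f).+1 by rewrite size_MXaddC (negPf f0).
have sq : (size (q%:P * g)%R < size h)%N.
  rewrite mul_polyC (leq_ltn_trans (size_scale_leq _ _)) // sh.
  by rewrite -[X in (X < _)%N]add0n ltn_add2r.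
exists (h + q%:P * g); split.
- rewrite (wevD _ _ (f * 'X)) wevMX wev_polyC mulrDl -mulrA (weyl_wev_l dx) -/L hE.
  by rewrite wevD wevCM.
- by rewrite size_polyDl // sfq sh.
rewrite lead_coefDl // hl lL [in RHS]lead_coefDl ?lead_coefMX //.
by rewrite size_mulX // (leq_ltn_trans (size_polyC_leq1 _)).
Qed.

Lemma weyl_exp_lead f n : f != 0 ->
  exists h, [/\ wemb f ^+ n = wemb h, size h = ((size f).-1 * n).+1 &
                lead_coef h = lead_coef f ^+ n].
Proof.
move=> f0; have sf : (0 < size f)%N by rewrite size_poly_gt0.
elim: n => [|n [h [hE hs hl]]].
  exists 1; rewrite !expr0 size_poly1 muln0 lead_coef1; split=> //.
  by rewrite wev_polyC rmorph1.
have h0 : h != 0 by rewrite -size_poly_gt0 hs.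
have [h' [hE' hs' hl']] := weyl_mul_lead f0 h0.
exists h'; rewrite !exprS hE hE' hl' hl; split=> //.
by rewrite hs' hs mulnS addnS -[X in (X + _)%N](prednK sf) addSn.
Qed.
End Weyl.

(** * The Weyl algebra in characteristic p *)

Lemma natr_pchar_eq0 (K : fieldType) p n : p \in [pchar K] ->
  (n%:R == 0 :> K) = (p %| n)%N.
Proof. by move=> chp; rewrite (dvdn_pcharf chp). Qed.

Lemma mulrn_pchar_eq0 (K : fieldType) p (c : K) n : p \in [pchar K] ->
  (c *+ n == 0) = (c == 0) || (p %| n)%N.
Proof. by move=> chp; rewrite -mulr_natr mulf_eq0 (natr_pchar_eq0 _ chp). Qed.

Lemma deriv_eq0_dvd (K : fieldType) p (q : {poly K}) i : p \in [pchar K] ->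
  q^`() = 0 -> q`_i != 0 -> (p %| i)%N.
Proof.
move=> chp q0; case: i => [|i] nz; first exact: dvdn0.
have /eqP := congr1 (fun r : {poly K} => r`_i) q0.
by rewrite coef_deriv coef0 (mulrn_pchar_eq0 _ _ chp) (negPf nz).
Qed.

Section WeylPchar.
Variables (K : fieldType) (p : nat) (A : algType K) (x d : A).
Hypotheses (chp : p \in [pchar K]) (hW : is_weyl1 x d).
Local Notation wemb := (wev x d).
Local Notation emb := (centre_emb x d p).

Let pp : prime p := pcharf_prime chp.
Let p0 : (0 < p)%N := prime_gt0 pp.

Let dx : d * x - x * d = 1. Proof. by case: hW. Qed.

Lemma emb_wev f : emb f = wev (x ^+ p) (d ^+ p) f.
Proof.
rewrite /wev (horner_coef_wide (n := size f)) ?size_poly //.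
apply: eq_bigr => j _; rewrite coef_map /= (@horner_algE _ _ _ _ _ (leqnn _)).
rewrite mulr_suml; apply: eq_bigr => i _.
by rewrite -scalerAl -!exprM.
Qed.

Lemma emb_expand f : emb f = wemb (expand p f).
Proof. by rewrite emb_wev wev_expand. Qed.

Lemma expand_central (f : {poly2 K}) : dX (expand p f) = 0 /\ dY (expand p f) = 0.
Proof.
have pK n : (p %| n)%N -> n%:R = 0 :> K by rewrite -(natr_pchar_eq0 _ chp) => /eqP.
split; apply/polyP => j; apply/polyP => i; rewrite !coef0.
  rewrite coef_dX coef_deriv coef_expand //; case: ifP => [/andP[_ pi]|_].
    by rewrite -mulr_natr pK // mulr0.
  by rewrite mul0rn.
rewrite /dY coef_deriv coefMn coef_expand //; case: ifP => [/andP[pj _]|_].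
  by rewrite -mulr_natr pK // mulr0.
by rewrite mul0rn.
Qed.

Lemma emb_central f b : emb f * b = b * emb f.
Proof.
rewrite emb_expand; move: b; apply/(central_wembP hW); exact: expand_central.
Qed.

Lemma emb_inj : injective emb.
Proof. by move=> f g; rewrite !emb_expand => /(wemb_inj hW)/expand_inj; apply. Qed.

(** In characteristic p, the vanishing of both partial derivatives of the coordinates leaves only
    exponents divisible by p. *)
Lemma central_emb a : (forall b, a * b = b * a) <-> exists f, a = emb f.
Proof.
split=> [|[f ->]]; last exact: emb_central.
rewrite -(wcoordK hW a) => /(central_wembP hW)[fX fY].
have [j i nz|g ->] := @expand_surj _ _ p0 (wcoord hW a); last first.
  by exists g; rewrite emb_expand.
apply/andP; split.
  case: j nz => [|j] nz; first exact: dvdn0.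
  have := congr1 (fun h : {poly2 K} => h`_j`_i) fY.
  rewrite /dY coef_deriv coefMn !coef0 => /eqP.
  by rewrite (mulrn_pchar_eq0 _ _ chp) (negPf nz).
apply: (deriv_eq0_dvd chp _ nz).
by rewrite -coef_dX fX coef0.
Qed.

Lemma embX : emb 'X%:P = x ^+ p. Proof. by rewrite emb_wev wevX. Qed.
Lemma embY : emb 'X = d ^+ p. Proof. by rewrite emb_wev wevY. Qed.
Lemma embC c : emb c%:P%:P = c%:A. Proof. by rewrite emb_wev wevC. Qed.
Lemma embD f g : emb (f + g) = emb f + emb g.
Proof. by rewrite !emb_wev wevD. Qed.
Lemma embM f g : emb (f * g) = emb f * emb g.
Proof.
by rewrite !emb_wev central_wevM // => a; rewrite -1?embX -1?embY emb_central.
Qed.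

Lemma is_restrictionP (s : A -> A) t : Kalg_hom s ->
  (forall f g, t (f + g) = t f + t g) -> (forall f g, t (f * g) = t f * t g) ->
  (forall c : K, t c%:P%:P = c%:P%:P) ->
  s x ^+ p = emb (t 'X%:P) -> s d ^+ p = emb (t 'X) -> is_restriction x d p s t.
Proof.
move=> hs tD tM tC eX eY f; symmetry; move: f.
apply: poly2_hom_ext => [f g|f g|f g|f g|c||].
- by rewrite embD (Kalg_homD hs).
- by rewrite embM (Kalg_homM hs).
- by rewrite tD embD.
- by rewrite tM embM.
- by rewrite tC embC (Kalg_homZ hs); case: hs => _ _ ->.
- by rewrite embX (Kalg_homX hs).
by rewrite embY (Kalg_homX hs).
Qed.

(** p times the order of P in d is 0, so P = q(x) with q^p = X^p, and Frobenius is injective on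
    K[X]. *)
Lemma weyl_root_x P : P ^+ p = x ^+ p -> P = x.
Proof.
rewrite -(wcoordK hW P); set f := wcoord hW P => E.
have Xp0 : ('X^p)%:P != 0 :> {poly2 K} by rewrite polyC_eq0 expf_neq0 ?polyX_eq0.
have xpE : x ^+ p = wemb ('X^p)%:P by rewrite wev_polyC rmorphXn /= horner_algX.
have f0 : f != 0.
  apply: contra_eq_neq E => ->; rewrite wev0 expr0n gtn_eqF // mulr0n xpE eq_sym.
  by rewrite -(wev0 x d) (inj_eq (wemb_inj hW)).
have [h [hE hs hl]] := weyl_exp_lead hW p f0.
have hX : h = ('X^p)%:P by apply: (wemb_inj hW); rewrite -hE E.
have sf : size f = 1%N.
  have : ((size f).-1 * p).+1 = 1%N.
    by rewrite -hs hX size_polyC expf_neq0 ?polyX_eq0.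
  case=> /eqP; rewrite muln_eq0 (gtn_eqF p0) orbF => /eqP sf.
  by rewrite -[size f]prednK ?size_poly_gt0 // sf.
have [q q0 fq] : exists2 q, q != 0 & f = q%:P by apply/size_poly1P; rewrite sf.
move: hl; rewrite hX fq !lead_coefC => /esym qE; rewrite wev_polyC.
have chP : p \in [pchar {poly K}] by rewrite (pchar_poly K).
suff -> : q = 'X by rewrite horner_algX.
apply/eqP; rewrite -subr_eq0.
have : (q - 'X) ^+ p == 0.
  rewrite -(pFrobenius_autE chP) pFrobenius_autB_comm; last exact: mulrC.
  by rewrite !pFrobenius_autE qE subrr.
by rewrite expf_eq0 p0.
Qed.

(** The commutator of v^n with x is n v^(n-1), which is 0 for n = p. *)
Lemma wemb_pow_central (v : A) : v * x - x * v = 1 -> exists2 h, v ^+ p = wemb h & dY h = 0.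
Proof.
move=> vx; exists (wcoord hW (v ^+ p)); first by rewrite wcoordK.
apply: (wemb_inj hW); rewrite -(comm_x hW) wcoordK wev0.
suff -> : v ^+ p * x - x * v ^+ p = v ^+ p.-1 *+ p.
  by rewrite -mulr_natl -[p%:R]scaler_nat (pcharf0 chp) scale0r mul0r.
elim: (p) => [|n IHn]; first by rewrite expr0 mulr1 mul1r subrr.
have vxE : v * x = x * v + 1 by rewrite -vx addrC subrK.
have IH : v ^+ n * x = x * v ^+ n + v ^+ n.-1 *+ n by rewrite -IHn addrC subrK.
have -> : v ^+ n.+1 * x = x * v ^+ n.+1 + v ^+ n *+ n.+1.
  rewrite exprS -mulrA IH mulrDr mulrA vxE mulrDl mul1r -addrA -mulrA; congr (_ + _).
  case: n {IHn IH} => [|n] /=; first by rewrite mulr0n mulr0 addr0.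
  by rewrite mulrnAr -exprS [RHS]mulrS.
by rewrite addrAC subrr add0r.
Qed.

Definition shear_op (g : {poly K}) (f : {poly2 K}) : {poly2 K} := dX f + f * 'X + g%:P * f.

Lemma shear_opE g f : (d + horner_alg x g) * wemb f = wemb (shear_op g f).
Proof. by rewrite mulrDl (weyl_wev_l dx) !wevD wevCM. Qed.

Lemma shear_op_coef0 g f : (shear_op g f)`_0 = (f`_0)^`() + g * f`_0.
Proof. by rewrite !coefD coef_dX coefMX coefCM addr0. Qed.

Lemma size_shear_op g f : f != 0 ->
  size (shear_op g f) = (size f).+1 /\ lead_coef (shear_op g f) = lead_coef f.
Proof.
move=> f0; have lt : (size (dX f + g%:P * f)%R < size (f * 'X)%R)%N.
  rewrite size_mulX // ltnS (leq_trans (size_polyD _ _)) // geq_max size_poly.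
  by rewrite mul_polyC size_scale_leq.
rewrite /shear_op addrAC addrC size_polyDl // lead_coefDl // size_mulX //.
by rewrite lead_coefMX.
Qed.

(** Besides the leading term in d, the part of order 0 is tracked: each step sends it to its
    derivative plus g times it, and the derivative has lower degree, so the degree in x grows by deg
    g. *)
Lemma shear_pow g n : exists h, [/\ (d + horner_alg x g) ^+ n = wemb h,
  size h = n.+1, lead_coef h = 1 & 
  (g != 0 -> size h`_0 = ((size g).-1 * n).+1 /\ lead_coef h`_0 = lead_coef g ^+ n)].
Proof.
elim: n => [|n [h [hE hs hl h0]]].
  exists 1; rewrite expr0 wev_polyC rmorph1 size_poly1 lead_coef1; split=> // _.
  by rewrite coef1 eqxx size_poly1 lead_coef1 muln0 expr0.
have hn0 : h != 0 by rewrite -size_poly_gt0 hs.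
have [so lo] := size_shear_op g hn0.
exists (shear_op g h); rewrite exprS hE shear_opE so lo hs hl; split=> // g0.
have [s0 l0] := h0 g0.
have b0 : h`_0 != 0 by rewrite -size_poly_gt0 s0.
have lt : (size (h`_0)^`() < size (g * h`_0)%R)%N.
  have sb : (0 < size (h`_0)%R)%N by rewrite size_poly_gt0.
  have sg : (0 < size g)%N by rewrite size_poly_gt0.
  apply: leq_trans (lt_size_deriv b0) _; rewrite size_mul //.
  by rewrite -(prednK sg) addSn /= leq_addl.
rewrite shear_op_coef0 addrC size_polyDl // lead_coefDl // lead_coefM l0 exprS.
split=> //; rewrite size_mul // s0 addnS /= mulnS.
by rewrite -[X in (X + _)%N]prednK ?size_poly_gt0 // addSn.
Qed.

(* (d + g)^p commutes with x and with d + g, which forces it to be d^p plus an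
   element of K[x^p]; Jacobson's formula for that element is not needed. *)
Lemma shear_pth_power g : g != 0 -> exists b,
  [/\ (d + horner_alg x g) ^+ p = emb ('X + b%:P), size b = size g
     & lead_coef b = lead_coef g ^+ p].
Proof.
move=> g0; have [h [hE hs hl h0]] := shear_pow g p.
have vx : (d + horner_alg x g) * x - x * (d + horner_alg x g) = 1.
  rewrite mulrDl mulrDr opprD addrACA dx -[RHS]addr0; congr (_ + _).
  have := comm_x hW g%:P; rewrite wev_polyC => ->.
  by rewrite /dY derivC wev0.
have [h' hE' hY] := wemb_pow_central vx.
have {h' hE'} hY : dY h = 0.
  by rewrite -hY; congr dY; apply: (wemb_inj hW); rewrite -hE -hE'.
(* By dY h = 0 only exponents of d divisible by p occur, and the order of h is p. *)
have hj j : h`_j != 0 -> j = 0%N \/ j = p.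
  move=> nz; case: j nz => [|j] nz; [by left | right].
  have [i nzi] : exists i, h`_j.+1`_i != 0.
    by exists (size h`_j.+1).-1; rewrite -/(lead_coef _) lead_coef_eq0.
  have /eqP := congr1 (fun q : {poly2 K} => q`_j`_i) hY.
  rewrite /dY coef_deriv coefMn !coef0 (mulrn_pchar_eq0 _ _ chp) (negPf nzi) /= => pj.
  apply/eqP; rewrite eqn_leq (dvdn_leq _ pj) // andbT -ltnS -hs.
  by rewrite ltnNge; apply: contraNN nz => sj; rewrite nth_default.
have hpE : h = 'X^p + (h`_0)%:P.
  apply/polyP => j; rewrite coefD coefXn coefC.
  have [jp|jp] := eqVneq j p.
    by rewrite jp (gtn_eqF p0) addr0 -hl /lead_coef hs.
  have [->|j0] := eqVneq j 0%N; first by rewrite add0r.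
  rewrite addr0; apply/eqP; apply: contraT => /hj[] e; first by rewrite e eqxx in j0.
  by rewrite e eqxx in jp.
(* The p-th power commutes with d + g(x) and with x, hence with g(x), and therefore with d. *)
have hX : dX h = 0.
  have Wx : wemb h * x = x * wemb h.
    by apply/eqP; rewrite -subr_eq0 (comm_x hW) hY wev0.
  have : wemb h * (d + horner_alg x g) = (d + horner_alg x g) * wemb h.
    by rewrite -hE -exprS -exprSr.
  rewrite mulrDl mulrDr comm_horner_alg // => /addIr E.
  by apply: (wemb_inj hW); rewrite -(comm_d hW) E subrr wev0.
have [f hf] : exists f, wemb h = emb f.
  by apply/central_emb; apply/(central_wembP hW).
have {hf} hf : h = expand p f by apply: (wemb_inj hW); rewrite hf emb_expand.
have coef_f j i : f`_j`_i = h`_(p * j)`_(p * i).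
  by rewrite hf coef_expand // !dvdn_mulr // !mulKn.
have fE : f = 'X + (f`_0)%:P.
  apply/polyP => j; rewrite coefD coefX coefC.
  case: j => [|[|j]] /=; rewrite ?add0r ?addr0 //; apply/polyP => i; rewrite coef_f.
    rewrite muln1 {1}hpE coefD coefXn coefC eqxx (gtn_eqF p0) addr0 !coef1.
    by rewrite muln_eq0 (gtn_eqF p0).
  rewrite hpE coefD coefXn coefC muln_eq0 (gtn_eqF p0) addr0 -{2}[p]muln1.
  by rewrite eqn_pmul2l // !coef0.
have b0E : h`_0 = f`_0 \Po 'X^p.
  by rewrite {1}hf coef_comp_poly_Xn // dvdn0 div0n coef_map.
have [s0 l0] := h0 g0.
have sb : ((size (f`_0)%R).-1 * p = (size g).-1 * p)%N.
  have := congr1 predn s0; rewrite b0E size_comp_poly size_polyXn /= => ->.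
  by [].
exists f`_0; rewrite -fE hE hf emb_expand; split=> //.
  have b0n : f`_0 != 0.
    by apply: contra_eq_neq s0 => b0; rewrite b0E b0 comp_poly0 size_poly0.
  have /eqP := sb; rewrite eqn_pmul2r // => /eqP sb'.
  by rewrite -[LHS]prednK ?size_poly_gt0 // sb' prednK // size_poly_gt0.
rewrite -l0 b0E lead_coef_comp ?size_polyXn ?ltnS // lead_coefXn expr1n mulr1 //.
Qed.

Lemma weyl_pth_root_d D lam : D * x - x * D = 1 -> D ^+ p = lam *: d ^+ p ->
  lam = 1 /\ D = d.
Proof.
move=> Dx Dp; pose f := wcoord hW D; have DE : wemb f = D by rewrite wcoordK.
have fY : dY f = 1.
  by apply: (wemb_inj hW); rewrite -(comm_x hW) DE Dx wev_polyC rmorph1.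
have f0 : f != 0.
  apply: contra_eq_neq fY => ->; rewrite /dY deriv0 eq_sym; exact: oner_neq0.
have [h [hE hs hl]] := weyl_exp_lead hW p f0.
have hlam : h = lam%:P%:P * 'X^p.
  apply: (wemb_inj hW); rewrite -hE DE Dp wevZ; congr (_ *: _).
  by rewrite -embY emb_expand /expand map_polyX comp_polyX.
have h0 : h != 0 by rewrite -size_poly_gt0 hs.
(* In characteristic p, dY f = 1 does not bound the order in d: p-th powers of Y have derivative 0.
   The order 1 is read off from D^p = lam d^p. *)
have sf : size f = 2%N.
  have lam0 : lam%:P != 0 :> {poly K}.
    by apply: contra_neq h0 => l0; rewrite hlam l0 polyC0 mul0r.
  have : ((size f).-1 * p).+1 = p.+1 by rewrite -hs hlam mul_polyC size_scale // size_polyXn.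
  case=> /eqP; rewrite -{2}[p]mul1n eqn_pmul2r // => /eqP sf.
  by rewrite -[LHS]prednK ?sf // size_poly_gt0.
have fE : f = 'X + (f`_0)%:P.
  have f1 : f`_1 = 1 by have := congr1 (fun q : {poly2 K} => q`_0) fY; rewrite coef_deriv coef1.
  apply/polyP => j; rewrite coefD coefX coefC; case: j => [|[|j]] /=.
  - by rewrite add0r.
  - by rewrite addr0.
  by rewrite addr0 nth_default ?sf.
have DE' : D = d + horner_alg x f`_0 by rewrite -DE {1}fE wevD wevY wev_polyC.
have [g0|g0] := eqVneq f`_0 0; last first.
  have [b [bE sb _]] := shear_pth_power g0.
  have E : 'X + b%:P = lam%:P%:P * 'X :> {poly2 K}.
    by apply: emb_inj; rewrite -bE -DE' Dp embM embC embY mulr_algl.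
  have := congr1 (fun q : {poly2 K} => q`_0) E.
  rewrite coefD coefX coefC coefCM coefX mulr0 add0r => b0.
  by move: sb; rewrite b0 size_poly0 => /esym/eqP; rewrite size_poly_eq0 (negPf g0).
have Dd : D = d by rewrite DE' g0 rmorph0 addr0.
split=> //; have E : 'X = lam%:P%:P * 'X :> {poly2 K}.
  by apply: emb_inj; rewrite embM embC embY mulr_algl -Dp Dd.
have := congr1 (fun q : {poly2 K} => q`_1`_0) E.
by rewrite coefCM coefX eqxx mulr1 coef1 coefC eqxx => <-.
Qed.
End WeylPchar.

(** * Automorphisms of K[X,Y] *)

Section PolynomialAutomorphisms.
Variable K : fieldType.
Local Notation Z := {poly2 K}.
Implicit Types (f g : Z) (t : Z -> Z).

Definition Zhom t : Prop :=
  [/\ forall u v, t (u + v) = t u + t v, forall u v, t (u * v) = t u * t v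
    & forall c : K, t c%:P%:P = c%:P%:P].

Definition subst (a b : Z) : Z -> Z := @ev2 K {poly2 K} (@polyC2 K) a b.

Lemma subst_hom a b : Zhom (subst a b).
Proof.
split=> [u v|u v|c]; [exact: rmorphD | exact: rmorphM | exact: ev2C].
Qed.

Lemma substX a b : subst a b 'X%:P = a. Proof. exact: ev2X. Qed.
Lemma substY a b : subst a b 'X = b. Proof. exact: ev2Y. Qed.

Lemma subst_polyC a b (q : {poly K}) : subst a%:P b q%:P = (q \Po a)%:P.
Proof.
have [sD sM sC] := subst_hom a%:P b.
elim/poly_ind: q => [|q c IHq].
  by rewrite comp_poly0; have := sC 0; rewrite !polyC0.
rewrite comp_polyD comp_polyM comp_polyX comp_polyC !polyCD !polyCM sD sM sC IHq.
by rewrite substX.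
Qed.

Lemma Zaut_hom t : Zaut t -> Zhom t. Proof. by case. Qed.

Lemma Zhom_ext t1 t2 : Zhom t1 -> Zhom t2 ->
  t1 'X%:P = t2 'X%:P -> t1 'X = t2 'X -> t1 =1 t2.
Proof.
move=> [D1 M1 C1] [D2 M2 C2]; apply: poly2_hom_ext => // c; by rewrite C1 C2.
Qed.

Lemma Zhom_comp t1 t2 : Zhom t1 -> Zhom t2 -> Zhom (t1 \o t2).
Proof.
by move=> [D1 M1 C1] [D2 M2 C2]; split=> [u v|u v|c] /=; rewrite ?D2 ?M2 ?C2.
Qed.

Lemma Zhom_id : Zhom id. Proof. by []. Qed.

Lemma Zaut_of_inverse t1 t2 : Zhom t1 -> Zhom t2 ->
  t2 (t1 'X%:P) = 'X%:P -> t2 (t1 'X) = 'X ->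
  t1 (t2 'X%:P) = 'X%:P -> t1 (t2 'X) = 'X -> Zaut t1.
Proof.
move=> h1 h2 e1 e2 e3 e4; case: (h1) => D1 M1 C1; split=> //; exists t2.
  exact: (Zhom_ext (Zhom_comp h2 h1) Zhom_id).
exact: (Zhom_ext (Zhom_comp h1 h2) Zhom_id).
Qed.

Lemma Zaut_comp t1 t2 : Zaut t1 -> Zaut t2 -> Zaut (t1 \o t2).
Proof.
move=> a1 a2; have [D M C] := Zhom_comp (Zaut_hom a1) (Zaut_hom a2).
by split=> //; case: a1 a2 => _ _ _ b1 [_ _ _ b2]; exact: bij_comp.
Qed.

Lemma Zaut_inv t : Zaut t -> exists t', [/\ Zhom t', cancel t t' & cancel t' t].
Proof.
case=> D M C [t' tK Kt]; exists t'; split=> //.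
have inj : injective t := can_inj tK.
split=> [u v|u v|c]; apply: inj; rewrite Kt; last by rewrite C.
  by rewrite D !Kt.
by rewrite M !Kt.
Qed.

Lemma Zaut_eq1 t f : Zaut t -> t f = 1 -> f = 1.
Proof.
case=> _ _ C bt tf; apply: (bij_inj bt).
by have := C 1; rewrite !polyC1 tf => ->.
Qed.

(** The chain rule for an arbitrary K-derivation, so that [dX] and [dY] are both instances. *)
Lemma Zhom_chain t (D : Z -> Z) f : Zhom t -> derivation D ->
  (forall c : K, D c%:P%:P = 0) ->
  D (t f) = t (dX f) * D (t 'X%:P) + t (dY f) * D (t 'X).
Proof.
move=> [tD tM tC] dD DC.
have t0 : t 0 = 0 by have := tC 0; rewrite !polyC0.
have t1 : t 1 = 1 by have := tC 1; rewrite !polyC1.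
have dx := derivation_dX K; have dy := derivation_dY K.
elim/poly2_ind: f => [c|||u v Hu Hv|u v Hu Hv].
- by rewrite tC DC dX_C dY_C t0 !mul0r addr0.
- by rewrite dX_X dY_X t0 t1 mul0r mul1r addr0.
- by rewrite dX_Y dY_Y t0 t1 mul0r mul1r add0r.
- by rewrite tD dD.1 Hu Hv dx.1 dy.1 !tD; ring.
by rewrite tM dD.2 Hu Hv dx.2 dy.2 !tD !tM; ring.
Qed.

Lemma jacobian_comp t1 t2 : Zhom t1 ->
  jacobian (t1 \o t2) = t1 (jacobian t2) * jacobian t1.
Proof.
move=> h1; case: (h1) => tD tM tC.
have tB u v : t1 (u - v) = t1 u - t1 v.
  by apply/eqP; rewrite eq_sym subr_eq -tD subrK.
rewrite /jacobian /polyX /polyY /= tB !tM.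
rewrite (Zhom_chain (t2 'X%:P) h1 (derivation_dX K) (@dX_C K)).
rewrite (Zhom_chain (t2 'X) h1 (derivation_dX K) (@dX_C K)).
rewrite (Zhom_chain (t2 'X%:P) h1 (derivation_dY K) (@dY_C K)).
rewrite (Zhom_chain (t2 'X) h1 (derivation_dY K) (@dY_C K)).
ring.
Qed.

Lemma eq_jacobian t1 t2 : t1 =1 t2 -> jacobian t1 = jacobian t2.
Proof. by move=> e; rewrite /jacobian !e. Qed.

Definition shearY (b : {poly K}) : Z -> Z := subst 'X%:P ('X + b%:P).
(** The sign gives Jacobian 1 and matches the lift x -> d, d -> -x; it also makes the map of order
    4. *)
Definition swap : Z -> Z := subst 'X (- 'X%:P).
Definition torus (c : K) : Z -> Z := subst (c *: 'X)%:P (c^-1%:P%:P * 'X).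
Definition scaleY (c : K) : Z -> Z := subst 'X%:P (c%:P%:P * 'X).

Lemma shearY_polyC b q : shearY b q%:P = q%:P.
Proof. by rewrite /shearY subst_polyC comp_polyXr. Qed.

Lemma shearYD b1 b2 : shearY b1 \o shearY b2 =1 shearY (b1 + b2).
Proof.
apply: Zhom_ext; [|exact: subst_hom| |].
- apply: Zhom_comp; exact: subst_hom.
- by rewrite /= !shearY_polyC.
have [sD _ _] := subst_hom 'X%:P ('X + b1%:P).
by rewrite /= {2}/shearY substY [LHS]sD -/(shearY b1) shearY_polyC [X in X + _]substY
  [RHS]substY -addrA polyCD.
Qed.

Lemma shearY_aut b : Zaut (shearY b).
Proof.
have inv c : shearY c (shearY (- c) 'X) = 'X.
  have := shearYD c (- c) 'X; rewrite /= subrr => ->.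
  by rewrite [LHS]substY polyC0 addr0.
apply: (@Zaut_of_inverse _ (shearY (- b))); rewrite ?shearY_polyC //;
  try exact: subst_hom.
by rewrite -{2}[b]opprK inv.
Qed.

Lemma jacobian_shearY b : jacobian (shearY b) = 1.
Proof.
rewrite /jacobian /polyX /polyY /= /shearY substX substY.
rewrite dX_X dY_X mul0r subr0 mul1r (derivation_dY K).1 dY_Y.
by rewrite /dY derivC addr0.
Qed.

Lemma swap_hom : Zhom swap. Proof. exact: subst_hom. Qed.

Lemma ZhomN t f : Zhom t -> t (- f) = - t f.
Proof.
move=> [D _ C]; have t0 : t 0 = 0 by have := C 0; rewrite !polyC0.
by apply: (addrI (t f)); rewrite -D !subrr.
Qed.

Lemma swap4 : swap \o swap \o swap \o swap =1 id.
Proof.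
have h2 := Zhom_comp swap_hom swap_hom.
apply: Zhom_ext; [exact: Zhom_comp (Zhom_comp h2 swap_hom) swap_hom|exact: Zhom_id| |] => /=;
by rewrite /swap !(substX, substY, ZhomN _ (subst_hom _ _)) ?opprK.
Qed.

Lemma swap_aut : Zaut swap.
Proof.
have h := swap_hom; have h2 := Zhom_comp h h.
apply: (Zaut_of_inverse h (Zhom_comp h2 h)).
- exact: (swap4 'X%:P).
- exact: (swap4 'X).
- exact: (swap4 'X%:P).
exact: (swap4 'X).
Qed.

Lemma jacobian_swap : jacobian swap = 1.
Proof.
rewrite /jacobian /polyX /polyY /= /swap substX substY.
by rewrite dX_Y dY_Y mul0r sub0r mul1r (derivationN _ (derivation_dX K)) dX_X opprK.
Qed.

Lemma torusC c : c != 0 -> torus c \o torus c^-1 =1 id.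
Proof.
move=> c0; have [sD sM sC] := subst_hom (c *: 'X)%:P (c^-1%:P%:P * 'X).
apply: Zhom_ext; [apply: Zhom_comp; exact: subst_hom|exact: Zhom_id| |] => /=.
  rewrite {2}/torus substX -mul_polyC polyCM -/(torus c) [LHS]sM [X in X * _]sC.
  by rewrite substX -mul_polyC polyCM mulrA -!polyCM mulVf // mul1r.
rewrite {2}/torus substY invrK -/(torus c) [LHS]sM [X in X * _]sC.
by rewrite substY mulrA -!polyCM divff // mul1r.
Qed.

Lemma torus_aut c : c != 0 -> Zaut (torus c).
Proof.
move=> c0; have c0' : c^-1 != 0 by rewrite invr_eq0.
have E1 := torusC c0; have E2 := torusC c0'; rewrite invrK in E2.
apply: (@Zaut_of_inverse _ (torus c^-1)).
- exact: subst_hom.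
- exact: subst_hom.
- exact: (E2 'X%:P).
- exact: (E2 'X).
- exact: (E1 'X%:P).
exact: (E1 'X).
Qed.
End PolynomialAutomorphisms.

Section ShearX.
Variable K : fieldType.
Local Notation Z := {poly2 K}.
Local Notation swapK := (@swap K).

Lemma dX_CM (c : K) (f : Z) : dX (c%:P%:P * f) = c%:P%:P * dX f.
Proof. by rewrite (derivation_dX K).2 dX_C mul0r add0r. Qed.

Lemma dY_CM (c : K) (f : Z) : dY (c%:P%:P * f) = c%:P%:P * dY f.
Proof. by rewrite (derivation_dY K).2 dY_C mul0r add0r. Qed.

Lemma jacobian_scaleY (c : K) : jacobian (scaleY c) = c%:P%:P.
Proof.
rewrite /jacobian /polyX /polyY /= /scaleY substX substY.
by rewrite dX_X !dY_CM dY_Y mulr1 mul1r dY_X mul0r subr0.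
Qed.

Lemma jacobian_torus (c : K) : c != 0 -> jacobian (torus c) = 1.
Proof.
move=> c0; rewrite /jacobian /polyX /polyY /= /torus substX substY -mul_polyC polyCM.
rewrite !dX_CM !dY_CM dX_X dY_X dY_Y !mulr1 mulr0 mul0r subr0.
by rewrite -!polyCM divff.
Qed.

(** The inverse of [swap], written as a cube so that lifting it only takes composition. *)
Definition swap3 : Z -> Z := swapK \o swapK \o swapK.

Lemma swap3_hom : Zhom swap3.
Proof. exact: Zhom_comp (Zhom_comp (swap_hom K) (swap_hom K)) (swap_hom K). Qed.

Lemma swap3_X : swap3 'X%:P = - 'X.
Proof. by rewrite /swap3 /= /swap !(substX, substY, ZhomN _ (subst_hom _ _)). Qed.

Lemma swap3_Y : swap3 'X = 'X%:P.
Proof. by rewrite /swap3 /= /swap !(substX, substY, ZhomN _ (subst_hom _ _)) ?opprK. Qed.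

Definition shearX (r : K) (j : nat) : Z -> Z := subst ('X%:P + r%:P%:P * 'X ^+ j) 'X.

Lemma Zhom0 (t : Z -> Z) : Zhom t -> t 0 = 0.
Proof. by move=> [_ _ C]; have := C 0; rewrite !polyC0. Qed.

Lemma ZhomX (t : Z -> Z) f n : Zhom t -> t (f ^+ n) = t f ^+ n.
Proof.
move=> [_ M C]; elim: n => [|n IHn]; first by have := C 1; rewrite !polyC1.
by rewrite !exprS M IHn.
Qed.

(** Conjugation by [swap] exchanges the two kinds of shears; the factor (-1)^j compensates for X ->
    -Y under [swap3]. *)
Lemma shearX_swap r j :
  shearX r j =1 swap3 \o shearY ((r * (-1) ^+ j) *: 'X^j) \o swapK.
Proof.
have h3 := swap3_hom; have [D3 M3 C3] := h3.
have hb b : Zhom (@shearY K b) by exact: subst_hom.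
apply: Zhom_ext; [exact: subst_hom|exact: Zhom_comp (Zhom_comp h3 (hb _)) (swap_hom K)| |].
  apply: etrans (substX _ _) _; rewrite [RHS]/= [swapK _]substX [shearY _ _]substY.
  rewrite D3 swap3_Y -mul_polyC polyCM M3 C3 polyC_exp (ZhomX _ _ h3) swap3_X [(- 'X) ^+ j]exprNn.
  rewrite mulrA; congr (_ + _ * _); rewrite !polyCM !rmorphXn /= !polyCN !polyC1.
  by rewrite -mulrA -exprMn mulrNN mulr1 expr1n mulr1.
apply: etrans (substY _ _) _; rewrite [RHS]/= [swapK _]substY (ZhomN _ (hb _)).
by rewrite shearY_polyC (ZhomN _ h3) swap3_X opprK.
Qed.
End ShearX.

(** Following the inequalities once around a cycle of length 4 turns them into equalities. For
    [swap] only upper bounds on degrees then have to be computed. *)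
Lemma order4_exchange (T : Type) (s : T -> T) (m n : T -> nat) :
  (forall f, (m (s f) <= n f)%N /\ (n (s f) <= m f)%N) ->
  (forall f, s (s (s (s f))) = f) -> forall f, m (s f) = n f /\ n (s f) = m f.
Proof.
move=> le s4 f; have [a1 b1] := le f; have [a2 b2] := le (s f).
have [a3 b3] := le (s (s f)); have := le (s (s (s f))); rewrite s4 => -[a4 b4].
by split; apply/eqP; rewrite eqn_leq ?a1 ?b1 /=;
  [exact: leq_trans b4 (leq_trans a3 b2) | exact: leq_trans a4 (leq_trans b3 a2)].
Qed.

(** * Lifting automorphisms to the Weyl algebra *)

Section Lift.
Variables (K : fieldType) (p : nat) (A : algType K) (x d : A).
Hypotheses (chp : p \in [pchar K]) (perfect : forall a : K, exists b : K, b ^+ p = a).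
Hypothesis hW : is_weyl1 x d.
Local Notation Z := {poly2 K}.
Local Notation swapK := (@swap K).
Local Notation emb := (centre_emb x d p).
Implicit Types t : Z -> Z.

Let dx : d * x - x * d = 1. Proof. by case: hW. Qed.

(** Jacobian 1 is included so that J(rho o t) = rho(J(t)) for every liftable rho. *)
Definition liftable t : Prop :=
  [/\ Zaut t, exists s, Kalg_aut s /\ is_restriction x d p s t & jacobian t = 1].

Lemma Kalg_aut_hom (s : A -> A) : Kalg_aut s -> Kalg_hom s.
Proof. by case. Qed.

Lemma Kalg_aut_comp (s1 s2 : A -> A) : Kalg_aut s1 -> Kalg_aut s2 -> Kalg_aut (s1 \o s2).
Proof.
move=> a1 a2; have [l m o] := Kalg_hom_comp (Kalg_aut_hom a1) (Kalg_aut_hom a2).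
by split=> //; case: a1 a2 => _ _ _ b1 [_ _ _ b2]; exact: bij_comp.
Qed.

Lemma Kalg_aut_inv (s : A -> A) : Kalg_aut s ->
  exists s', [/\ Kalg_aut s', cancel s s' & cancel s' s].
Proof.
case=> l m o [s' sK Ks]; exists s'; split=> //.
have inj : injective s := can_inj sK.
split=> [c u v|u v||]; last by exists s.
- by apply: inj; rewrite l !Ks.
- by apply: inj; rewrite m !Ks.
by apply: inj; rewrite Ks o.
Qed.

Lemma is_restriction_comp (s1 s2 : A -> A) t1 t2 :
  is_restriction x d p s1 t1 -> is_restriction x d p s2 t2 ->
  is_restriction x d p (s1 \o s2) (t1 \o t2).
Proof. by move=> r1 r2 f; rewrite /= r1 r2. Qed.

Lemma liftable_comp t1 t2 : liftable t1 -> liftable t2 -> liftable (t1 \o t2).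
Proof.
move=> [a1 [s1 [S1 r1]] j1] [a2 [s2 [S2 r2]] j2]; split; first exact: Zaut_comp.
  exists (s1 \o s2); split; [exact: Kalg_aut_comp | exact: is_restriction_comp].
rewrite (jacobian_comp _ (Zaut_hom a1)) j1 j2 mulr1.
by case: a1 => _ _ C _; have := C 1; rewrite !polyC1.
Qed.

Lemma eq_liftable t1 t2 : t1 =1 t2 -> liftable t1 -> liftable t2.
Proof.
move=> e [[D M C b] [s [S r]] j]; split.
- split=> [u v|u v|c|]; rewrite -?e //; exact: eq_bij e.
- by exists s; split=> // f; rewrite -e.
by rewrite -(eq_jacobian e).
Qed.

(** (u, v) are the images of (x, d) under the lift and (u', v') those under its inverse. Both pairs
    extend to endomorphisms, and the two functional hypotheses say that these are mutually inverse
    on the generators. *)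
Lemma lift_of_pairs t (u v u' v' : A) : Zaut t -> jacobian t = 1 ->
  v * u - u * v = 1 -> v' * u' - u' * v' = 1 ->
  (forall s, Kalg_hom s -> s x = u -> s d = v -> s u' = x /\ s v' = d) ->
  (forall s, Kalg_hom s -> s x = u' -> s d = v' -> s u = x /\ s v = d) ->
  u ^+ p = emb (t 'X%:P) -> v ^+ p = emb (t 'X) -> liftable t.
Proof.
move=> at_ jt w w' H H' eX eY; have [s [hs sx sd]] := endo_exists hW w.
have [s' [hs' sx' sd']] := endo_exists hW w'.
have [e1 e2] := H s hs sx sd; have [e3 e4] := H' s' hs' sx' sd'.
split=> //; exists s; split.
  by apply: (aut_of_inverse hW hs hs'); rewrite ?sx ?sd ?sx' ?sd'.
by case: at_ => tD tM tC _; apply: (is_restrictionP chp); rewrite ?sx ?sd.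
Qed.

Lemma liftable_swap : liftable (@swap K).
Proof.
have chA : p \in [pchar A] by apply: (rmorph_pchar (in_alg A)).
have N a : (- a) ^+ p = - (a ^+ p) :> A by exact: (pFrobenius_autN chA).
have w : (- x) * d - d * (- x) = 1 by rewrite mulNr mulrN opprK addrC.
have w' : x * (- d) - (- d) * x = 1 by rewrite mulNr mulrN opprK addrC.
apply: (lift_of_pairs (swap_aut K) (jacobian_swap K) w w').
- move=> s hs sx sd; rewrite sx; split=> //.
  by rewrite -[- d]add0r (Kalg_homB hs) (Kalg_hom0 hs) sd sub0r opprK.
- move=> s hs sx sd; rewrite sd; split=> //.
  by rewrite -[- x]add0r (Kalg_homB hs) (Kalg_hom0 hs) sx sub0r opprK.
- by rewrite [X in emb X]substX embY.
rewrite [X in emb X]substY N -(embX p x d).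
by apply/eqP; rewrite eq_sym -subr_eq0 opprK -embD addNr emb_wev wev0.
Qed.

(** The lift is x -> b x, d -> b^-1 d with b^p = c, which exists as K is perfect. *)
Lemma liftable_torus c : c != 0 -> liftable (torus c).
Proof.
move=> c0; have [b bE] := perfect c.
have b0 : b != 0.
  by apply: contra_neq c0 => b0; rewrite -bE b0 expr0n gtn_eqF ?(prime_gt0 (pcharf_prime chp)).
have w e : e != 0 -> (e^-1 *: d) * (e *: x) - (e *: x) * (e^-1 *: d) = 1.
  move=> e0; rewrite -!scalerAl -!scalerAr !scalerA mulVf // divff // !scale1r //.
have bv0 : b^-1 != 0 by rewrite invr_eq0.
have w' := w _ bv0; rewrite invrK in w'.
apply: (lift_of_pairs (torus_aut c0) (jacobian_torus c0) (w _ b0) w').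
- move=> s hs sx sd; rewrite !(Kalg_homZ hs) sx sd !scalerA mulVf // divff //.
  by rewrite !scale1r.
- move=> s hs sx sd; rewrite !(Kalg_homZ hs) sx sd !scalerA mulVf // divff //.
  by rewrite !scale1r.
- rewrite [X in emb X]substX exprZn bE -mul_polyC polyCM (embM chp hW).
  by rewrite embC embX mulr_algl.
rewrite [X in emb X]substY exprZn exprVn bE (embM chp hW).
by rewrite embC embY mulr_algl.
Qed.

(** The lift is d -> d + g(x), with inverse d -> d - g(x). Knowing the leading term of the
    polynomial it adds to Y is enough for an induction on the degree. *)
Lemma liftable_shear_lead (g : {poly K}) : g != 0 -> exists b,
  [/\ liftable (shearY b), size b = size g & lead_coef b = lead_coef g ^+ p].
Proof.
move=> g0; have [b [bE sb lb]] := shear_pth_power chp hW g0.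
exists b; split=> //.
have w h : (d + horner_alg x h) * x - x * (d + horner_alg x h) = 1.
  by rewrite mulrDl mulrDr opprD addrACA dx (comm_horner_alg h (erefl (x * x))) subrr addr0.
apply: (lift_of_pairs (shearY_aut b) (jacobian_shearY b) (w g) (w (- g))).
- move=> s hs sx sd; split=> //.
  by rewrite (Kalg_homD hs) sd (Kalg_hom_horner hs) sx rmorphN addrK.
- move=> s hs sx sd; split=> //.
  by rewrite (Kalg_homD hs) sd (Kalg_hom_horner hs) sx rmorphN subrK.
- by rewrite [X in emb X]substX embX.
by rewrite [X in emb X]substY.
Qed.

Lemma liftable_id : liftable id.
Proof.
split; first by split=> //; exists id.
  by exists id; split=> //; split=> //; exists id.
by rewrite /jacobian /polyX /polyY dX_X dX_Y dY_X dY_Y mulr1 mul0r subr0.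
Qed.

(* Induction on the degree: as K is perfect, a shear d |-> d + e x^k realizes a
   polynomial with any prescribed leading term. *)
Lemma liftable_shearY (b : {poly K}) : liftable (shearY b).
Proof.
have [n] := ubnP (size b); elim: n b => // n IHn b; rewrite ltnS => sb.
have [->|b0] := eqVneq b 0.
  apply: (eq_liftable _ liftable_id); apply: Zhom_ext; [exact: Zhom_id|exact: subst_hom| |].
    by rewrite [RHS]substX.
  by rewrite [RHS]substY polyC0 addr0.
have sbp : (0 < size b)%N by rewrite size_poly_gt0.
have [e eE] := perfect (lead_coef b).
have e0 : e != 0.
  apply: contra_neq b0 => e0; apply/eqP; rewrite -lead_coef_eq0 -eE e0 expr0n.
  by rewrite gtn_eqF ?(prime_gt0 (pcharf_prime chp)).
have sg : size (e *: 'X^((size b).-1)) = size b.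
  by rewrite size_scale // size_polyXn prednK.
have [|b1 [L1 s1 l1]] := @liftable_shear_lead (e *: 'X^((size b).-1)).
  by rewrite -size_poly_gt0 sg.
rewrite lead_coefZ lead_coefXn mulr1 eE in l1; rewrite sg in s1.
have sd : (size (b - b1)%R < n)%N.
  apply: leq_trans sb; rewrite -[X in (_ < X)%N](prednK sbp) ltnS.
  apply/leq_sizeP => j; rewrite coefB leq_eqVlt => /orP[/eqP <-|hj].
    by move: l1; rewrite /lead_coef s1 => ->; rewrite subrr.
  by rewrite !nth_default ?subrr // ?s1 -(prednK sbp).
apply: (eq_liftable _ (liftable_comp (IHn _ sd) L1)).
by move=> f; rewrite shearYD subrK.
Qed.

Lemma liftable_swap3 : liftable (@swap3 K).
Proof. exact: liftable_comp (liftable_comp liftable_swap liftable_swap) liftable_swap. Qed.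

Lemma liftable_shearX r j : liftable (@shearX K r j).
Proof.
apply: (eq_liftable (fsym (shearX_swap r j))).
exact: liftable_comp (liftable_comp liftable_swap3 (liftable_shearY _)) liftable_swap.
Qed.

(** * Reduction of automorphisms of K[X,Y] to a scaling of Y *)

Definition tame t : Prop :=
  exists rho lam, [/\ liftable rho, lam != 0 & rho \o t =1 @scaleY K lam].

Lemma tame_comp rho t : liftable rho -> tame (rho \o t) -> tame t.
Proof.
move=> Lr [rho' [lam [L l0 E]]]; exists (rho' \o rho), lam; split=> //.
exact: liftable_comp.
Qed.

Lemma Zhom_comp_poly t (q : {poly K}) f : Zhom t -> t 'X%:P = q%:P ->
  t f = map_poly (comp_poly q) f \Po t 'X.
Proof.
move=> ht tX; have e : t =1 subst q%:P (t 'X).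
  by apply: Zhom_ext => //; [exact: subst_hom|rewrite substX|rewrite substY].
have [tD tM _] := ht; elim/poly_ind: f => [|f u IHf].
  by rewrite rmorph0 comp_poly0 Zhom0.
rewrite tD tM rmorphD rmorphM /= map_polyX map_polyC /= comp_polyD comp_polyM.
by rewrite comp_polyX comp_polyC IHf (e u%:P) subst_polyC.
Qed.

(** Here t(X) = q(X). Writing Y and X as images under t and comparing degrees of compositions shows
    that t(Y) has degree 1 in Y and q has degree 1; the leading coefficient of t(Y) is a unit of
    K[X], hence a constant. Torus, translation and shear remove the rest. *)
Lemma tame_base t : Zaut t -> (size (t 'X%:P) <= 1)%N -> tame t.
Proof.
move=> at_ /size1_polyC; set q := (t _)`_0 => tX.
have ht := Zaut_hom at_; have [t' [ht' tK Kt]] := Zaut_inv at_.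
pose g := t 'X; pose h f := map_poly (comp_poly q) f.
have tE f : t f = h f \Po g by exact: Zhom_comp_poly.
have /(congr1 (fun f : Z => size f)) := tE (t' 'X); rewrite Kt size_polyX => sE.
have := size_comp_poly (h (t' 'X)) g; rewrite -sE /= => /esym/eqP.
rewrite muln_eq1 => /andP[/eqP sh /eqP sg].
have sg2 : size g = 2%N by rewrite -[LHS]prednK ?sg //; case: (size g) sg.
have : lead_coef (h (t' 'X)) * lead_coef g = 1.
  have := congr1 (fun f : Z => lead_coef f) (tE (t' 'X)).
  by rewrite Kt lead_coefX lead_coef_comp ?sg2 // sh expr1 => <-.
move=> lg; have ug : lead_coef g \is a GRing.unit.
  by apply/unitrP; exists (lead_coef (h (t' 'X))); rewrite lg mulrC lg.
move: ug; rewrite poly_unitE => /andP[/eqP slg _].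
have [gam gam0 gE] : exists2 c, c != 0 & lead_coef g = c%:P by apply/size_poly1P; rewrite slg.
have gE2 : g = gam%:P%:P * 'X + (g`_0)%:P.
  apply/polyP => j; rewrite coefD coefCM coefX coefC; case: j => [|[|j]] /=.
  - by rewrite mulr0 add0r.
  - by rewrite mulr1 addr0 -gE /lead_coef sg2.
  by rewrite mulr0 addr0 nth_default // sg2.
have [al [be [al0 qE]]] : exists al be, al != 0 /\ q = al *: 'X + be%:P.
  have := tE (t' 'X%:P); rewrite Kt => E.
  have sh1 : (size (h (t' 'X%:P)) <= 1)%N.
    have := size_comp_poly (h (t' 'X%:P)) g; rewrite -E sg2 muln1 size_polyC polyX_eq0 /=.
    by case: (size _) => [|[]].
  have hE : 'X = (t' 'X%:P)`_0 \Po q.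
    move: E; rewrite (size1_polyC sh1) comp_polyC => /polyC_inj e.
    by rewrite [LHS]e /h coef_map.
  have := size_comp_poly (t' 'X%:P)`_0 q; rewrite -hE size_polyX /= => /esym/eqP.
  rewrite muln_eq1 => /andP[_ /eqP sq].
  have sq2 : size q = 2%N by rewrite -[LHS]prednK ?sq //; case: (size q) sq.
  exists q`_1, q`_0; split.
    by have := lead_coef_eq0 q; rewrite /lead_coef sq2 /= => ->; rewrite -size_poly_gt0 sq2.
  apply/polyP => j; rewrite coefD coefZ coefX coefC; case: j => [|[|j]] /=.
  - by rewrite mulr0 add0r.
  - by rewrite mulr1 addr0.
  by rewrite mulr0 addr0 nth_default // sq2.
have av0 : al^-1 != 0 by rewrite invr_eq0.
(* [r1] normalizes the coefficient of X and multiplies Y by al, whence lam = gam al; [r2], a shear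
   with exponent 0, translates X by -be. *)
pose lam := gam * al; pose r1 := @torus K al^-1; pose r2 := @shearX K (- be) 0.
have lam0 : lam != 0 by rewrite mulf_neq0.
have [D1 M1 C1] : Zhom r1 by exact: subst_hom.
have h2 : Zhom r2 by exact: subst_hom.
have [D2 M2 C2] := h2.
have X2 : r2 (r1 (t 'X%:P)) = 'X%:P.
  rewrite tX qE -mul_polyC !polyCD !polyCM D1 M1 !C1 [r1 'X%:P]substX -mul_polyC polyCM.
  rewrite mulrA -!polyCM mulfV // !polyC1 mul1r D2 C2 [r2 _]substX expr0 mulr1.
  by rewrite !polyCN -addrA addNr addr0.
have [q3 Y2] : exists q3 : {poly K}, r2 (r1 (t 'X)) = lam%:P%:P * 'X + q3%:P.
  rewrite -/g gE2 D1 M1 C1 [r1 'X]substY invrK mulrA -!polyCM -/lam D2 M2 C2 [r2 'X]substY.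
  rewrite [r1 _]subst_polyC /r2 /shearX.
  have -> : 'X%:P + (- be)%:P%:P * 'X ^+ 0 = ('X - be%:P)%:P :> Z.
    by rewrite expr0 mulr1 !polyCN -polyCB.
  by rewrite subst_polyC; eexists.
pose r3 := @shearY K (- (lam^-1 *: q3)).
have h3 : Zhom r3 by exact: subst_hom.
exists (r3 \o r2 \o r1), lam; split=> //.
  apply: liftable_comp; last exact: liftable_torus.
  by apply: liftable_comp; [exact: liftable_shearY | exact: liftable_shearX].
have h1 : Zhom r1 by exact: subst_hom.
apply: Zhom_ext; [exact: Zhom_comp (Zhom_comp (Zhom_comp h3 h2) h1) ht|exact: subst_hom| |].
  by rewrite [LHS]/= X2 [LHS]shearY_polyC [RHS]substX.
have [D3 M3 C3] := h3.
rewrite [LHS]/= Y2 D3 M3 C3 [r3 'X]substY [r3 _]shearY_polyC [RHS]substY mulrDr -addrA.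
rewrite -[RHS]addr0; congr (_ + _).
by rewrite -polyCM mul_polyC scalerN scalerA divff // scale1r polyCN addNr.
Qed.

Lemma size_swap_le (f : Z) :
  (size (swapK f) <= sizeY f)%N /\ (sizeY (swapK f) <= size f)%N.
Proof.
have fE : swapK f = \sum_(j < size f) \sum_(i < sizeY f)
    (f`_j`_i)%:P%:P * (((- 'X) ^+ j)%:P * 'X ^+ i).
  rewrite /swap /subst [LHS](ev2E _ _ _ (leqnn _) (leqnn _)).
  apply: eq_bigr => j _; apply: eq_bigr => i _.
  by rewrite -mulrA polyC_exp polyCN; congr (_ * _); rewrite mulrC.
split.
  rewrite fE; apply: (leq_trans (size_sum _ _ _)); apply/bigmax_leqP => j _.
  apply: (leq_trans (size_sum _ _ _)); apply/bigmax_leqP => i _.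
  rewrite !mul_polyC; do 2!apply: leq_trans (size_scale_leq _ _) _.
  by rewrite size_polyXn.
have gE : swapXY (swapK f) = \sum_(j < size f) \sum_(i < sizeY f)
    (f`_j`_i)%:P%:P * (('X ^+ i)%:P * (- 'X) ^+ j).
  rewrite fE rmorph_sum; apply: eq_bigr => j _; rewrite rmorph_sum.
  apply: eq_bigr => i _; rewrite !rmorphM !rmorphXn /= swapXY_X !swapXY_polyC map_polyC /=.
  by rewrite rmorphN /= map_polyX -polyC_exp; congr (_ * _); rewrite mulrC.
rewrite sizeYE gE; apply: (leq_trans (size_sum _ _ _)); apply/bigmax_leqP => j _.
apply: (leq_trans (size_sum _ _ _)); apply/bigmax_leqP => i _.
rewrite !mul_polyC; do 2!apply: leq_trans (size_scale_leq _ _) _.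
have sX : (size (- 'X : Z) <= 2)%N by rewrite size_polyN size_polyX.
by apply: leq_trans (size_exp_le j sX) _; rewrite mul1n.
Qed.

Lemma size_swap (f : Z) : size (swapK f) = sizeY f /\ sizeY (swapK f) = size f.
Proof.
exact: (order4_exchange (n := @sizeY K) (m := fun g : Z => size g) size_swap_le (@swap4 K)).
Qed.

Lemma Zaut_coaction t : Zaut t -> exists xi eta : {poly Z},
  [/\ xi`_0 = 'X%:P, eta`_0 = 'X, ~~ ((size xi <= 1) && (size eta <= 1))%N &
      @ev2 K {poly Z} (@polyC3 K) xi eta (t 'X%:P) = (t 'X%:P)%:P].
Proof.
move=> at_; have [t' [ht' tK Kt]] := Zaut_inv at_; have ht := Zaut_hom at_.
have [tD tM tC] := ht; have [tD' tM' tC'] := ht'.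
pose ev (a b : {poly Z}) : Z -> {poly Z} := @ev2 K {poly Z} (@polyC3 K) a b.
have evD a b u v : ev a b (u + v) = ev a b u + ev a b v by exact: rmorphD.
have evM a b u v : ev a b (u * v) = ev a b u * ev a b v by exact: rmorphM.
have evC a b c : ev a b c%:P%:P = c%:P%:P%:P by exact: ev2C.
have evX a b : ev a b 'X%:P = a by exact: ev2X.
have evY a b : ev a b 'X = b by exact: ev2Y.
(* Evaluation at (a, b) is the translation Y -> Y + T followed by t; composing it with t' on the
   inside conjugates the translation by t. *)
pose a := (t 'X%:P)%:P; pose b := (t 'X)%:P + 'X.
pose xi := ev a b (t' 'X%:P); pose eta := ev a b (t' 'X).
have E f : ev xi eta f = ev a b (t' f).
  apply: (poly2_hom_ext (h2 := fun f => ev a b (t' f))) => [u v|u v|u v|u v|c||] //.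
  - by rewrite tD' evD.
  - by rewrite tM' evM.
  by rewrite tC' !evC.
have E0 f : (ev a b f)`_0 = t f.
  apply: (poly2_hom_ext (h1 := fun f => (ev a b f)`_0) (h2 := t)) => [u v|u v|u v|u v|c||].
  - by rewrite evD coefD.
  - by rewrite evM coef0M.
  - exact: tD.
  - exact: tM.
  - by rewrite evC coefC tC.
  - by rewrite evX coefC.
  by rewrite evY coefD coefC coefX addr0.
exists xi, eta; split.
- by rewrite E0 Kt.
- by rewrite E0 Kt.
(* If xi and eta were constant in T, everything would be fixed, but t(Y) is sent to t(Y) + T. *)
- apply/negP => /andP[/size1_polyC sx /size1_polyC se].
  have := E (t 'X); rewrite tK evY sx se !E0 !Kt [LHS]ev2_polyC3 => /esym/eqP.
  by rewrite /b -subr_eq0 addrAC subrr add0r polyX_eq0.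
by rewrite [LHS]E tK evX.
Qed.

Lemma tame_le t : Zaut t -> (sizeY (t 'X%:P) <= size (t 'X%:P))%N ->
  (forall t1, Zaut t1 -> (size (t1 'X%:P) + sizeY (t1 'X%:P) <
      size (t 'X%:P) + sizeY (t 'X%:P))%N -> tame t1) -> tame t.
Proof.
move=> at_ le IH; case: (leqP (sizeY (t 'X%:P)) 1) => sY.
  apply: (tame_comp liftable_swap); apply: tame_base.
    exact: Zaut_comp (swap_aut K) at_.
  by rewrite /= (size_swap _).1.
have [xi [eta [xi0 eta0 nc E]]] := Zaut_coaction at_.
have [r [j [l1 l2]]] := shear_reduction xi0 eta0 nc E sY le.
apply: (tame_comp (liftable_shearX r j)); apply: IH.
  by apply: Zaut_comp at_; case: (liftable_shearX r j).
by rewrite -addSn leq_add.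
Qed.

Lemma Zaut_tame t : Zaut t -> tame t.
Proof.
have [n] := ubnP (size (t 'X%:P) + sizeY (t 'X%:P)); elim: n t => // n IHn t.
rewrite ltnS => sn at_.
have IH t1 : Zaut t1 -> (size (t1 'X%:P) + sizeY (t1 'X%:P) <
    size (t 'X%:P) + sizeY (t 'X%:P))%N -> tame t1.
  by move=> a1 lt; apply: IHn => //; apply: leq_trans lt sn.
case: (leqP (sizeY (t 'X%:P)) (size (t 'X%:P))) => le; first exact: tame_le.
apply: (tame_comp liftable_swap); apply: tame_le.
- exact: Zaut_comp (swap_aut K) at_.
- by rewrite /= (size_swap _).1 (size_swap _).2 ltnW.
by move=> t1; rewrite /= (size_swap _).1 (size_swap _).2 [X in (_ < X)%N]addnC; apply: IH.
Qed.

(** * Restriction of automorphisms to the centre *)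

Lemma restriction_exists s : Kalg_aut s -> exists t, Zaut t /\ is_restriction x d p s t.
Proof.
move=> as_; have hs := Kalg_aut_hom as_; have [s' [as' sK Ks]] := Kalg_aut_inv as_.
have cent (s1 : A -> A) : Kalg_aut s1 -> forall f, exists g, s1 (emb f) == emb g.
  move=> a1 f; have [s2 [a2 s1K Ks1]] := Kalg_aut_inv a1.
  have [|g ->] := (central_emb chp hW (s1 (emb f))).1; last by exists g.
  move=> b; have h1 := Kalg_aut_hom a1; rewrite -(Ks1 b).
  by rewrite -!(Kalg_homM h1) (emb_central chp hW).
pose t f := xchoose (cent s as_ f); pose t' f := xchoose (cent s' as' f).
have tE f : emb (t f) = s (emb f) by rewrite -(eqP (xchooseP (cent s as_ f))).
have tE' f : emb (t' f) = s' (emb f) by rewrite -(eqP (xchooseP (cent s' as' f))).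
have inj := emb_inj chp hW.
exists t; split; last by move=> f; rewrite tE.
split=> [u v|u v|c|].
- by apply: inj; rewrite tE !embD !tE (Kalg_homD hs).
- by apply: inj; rewrite tE !(embM chp hW) !tE (Kalg_homM hs).
- by apply: inj; rewrite tE embC (Kalg_homZ hs); case: hs => _ _ ->.
by exists t' => f; apply: inj; rewrite ?tE' ?tE ?sK ?Ks ?tE' ?tE ?sK ?Ks.
Qed.

(** The inverse of s2 composed with s1 fixes x^p and d^p. The uniqueness of p-th roots, with lam = 1
    in [weyl_pth_root_d], then makes it fix x and d. *)
Lemma restriction_inj s1 s2 t : Kalg_aut s1 -> Kalg_aut s2 ->
  is_restriction x d p s1 t -> is_restriction x d p s2 t -> s1 =1 s2.
Proof.
move=> a1 a2 r1 r2; have [s2' [a2' s2K Ks2]] := Kalg_aut_inv a2.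
have h1 := Kalg_aut_hom a1; have h2' := Kalg_aut_hom a2'.
have h := Kalg_hom_comp h2' h1.
have fixed f : s2' (s1 (emb f)) = emb f by rewrite -r1 r2 s2K.
have ex : s2' (s1 x) = x.
  apply: (weyl_root_x chp hW); rewrite -(Kalg_homX h2') -(Kalg_homX h1).
  by rewrite -(embX p x d) fixed.
have ed : s2' (s1 d) = d.
  have Dx : s2' (s1 d) * x - x * s2' (s1 d) = 1.
    rewrite -{1 2}ex -!(Kalg_homM h2') -!(Kalg_homM h1) -(Kalg_homB h2') -(Kalg_homB h1).
    by rewrite dx; case: h.
  have [//|_ ->//] := weyl_pth_root_d chp hW (lam := 1) Dx.
  by rewrite scale1r -(Kalg_homX h2') -(Kalg_homX h1) -(embY p x d) fixed.
move=> a; rewrite -[LHS]Ks2; congr s2.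
exact: (hom_ext hW h (@Kalg_hom_id K A) ex ed).
Qed.

Lemma scaleY_lift_eq1 s lam : Kalg_aut s ->
  is_restriction x d p s (@scaleY K lam) -> lam = 1.
Proof.
move=> as_ r; have hs := Kalg_aut_hom as_.
have sx : s x = x.
  apply: (weyl_root_x chp hW); rewrite -(Kalg_homX hs) -(embX p x d) -r.
  by rewrite [X in emb X]substX.
have Dx : s d * x - x * s d = 1.
  by rewrite -{1 2}sx -!(Kalg_homM hs) -(Kalg_homB hs) dx; case: hs.
have [] // := weyl_pth_root_d chp hW (lam := lam) Dx.
rewrite -(Kalg_homX hs) -(embY p x d) -r [X in emb X]substY (embM chp hW) embC embY.
by rewrite mulr_algl.
Qed.

Lemma restriction_jacobian t : Zaut t ->
  (exists s, Kalg_aut s /\ is_restriction x d p s t) <-> jacobian t = 1.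
Proof.
move=> at_; have [rho [lam [[ar [s1 [as1 r1]] jr] lam0 E]]] := Zaut_tame at_.
have jE : rho (jacobian t) = lam%:P%:P.
  have := jacobian_comp t (Zaut_hom ar).
  by rewrite jr mulr1 (eq_jacobian E) jacobian_scaleY => <-.
have rho1 : rho 1 = 1 by case: ar => _ _ C _; have := C 1; rewrite !polyC1.
split=> [[s [as_ r]]|jt].
  have lam1 : lam = 1.
    apply: (@scaleY_lift_eq1 (s1 \o s)); first exact: Kalg_aut_comp.
    by move=> f; rewrite -E; exact: is_restriction_comp.
  by apply: (Zaut_eq1 ar); rewrite jE lam1 !polyC1.
have lam1 : lam = 1.
  by move: jE; rewrite jt rho1 => /esym/eqP; rewrite -!polyC1 !(inj_eq (@polyC_inj _)) => /eqP.
(* With lam = 1, rho o t is the identity, so the inverse of the lift of rho is a lift of t. *)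
have [s1' [as1' s1K Ks1]] := Kalg_aut_inv as1.
exists s1'; split=> // f; have rt : rho (t f) = f.
  have := E f; rewrite /= => ->.
  rewrite lam1; apply: (Zhom_ext (t2 := id) (subst_hom _ _) (Zhom_id K)).
    by rewrite substX.
  by rewrite substY !polyC1 mul1r.
by rewrite -[RHS](f_equal (fun g => s1' (emb g)) rt) r1 s1K.
Qed.
End Lift.

Theorem theorem1p1 (K : fieldType) (p : nat) (A : algType K) (x d : A) :
  perfect_pchar K p -> is_weyl1 x d ->
  (* Z = K[X,Y]: centre_emb is injective and its image is the centre of A_1 *)
  [/\ injective (centre_emb x d p) /\
      (forall a : A, (forall b : A, a * b = b * a) <-> exists f, a = centre_emb x d p f),
  (* res is well defined: every K-automorphism restricts to an automorphism of Z *)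
      (forall s, Kalg_aut s -> exists t, Zaut t /\ is_restriction x d p s t),
  (* res is a group homomorphism *)
      (forall s1 s2 t1 t2, Kalg_aut s1 -> Kalg_aut s2 -> Zaut t1 -> Zaut t2 ->
         is_restriction x d p s1 t1 -> is_restriction x d p s2 t2 ->
         is_restriction x d p (s1 \o s2) (t1 \o t2)),
  (* res is injective *)
      (forall s1 s2 t, Kalg_aut s1 -> Kalg_aut s2 ->
         is_restriction x d p s1 t -> is_restriction x d p s2 t -> s1 =1 s2) &
  (* the image of res is Gamma = {t | J(t) = 1} *)
      (forall t, Zaut t ->
         (exists s, Kalg_aut s /\ is_restriction x d p s t) <-> jacobian t = 1)].
Proof.
case=> chp perfect hW; split.
- by split; [exact: emb_inj chp hW | exact: central_emb chp hW].
- exact: restriction_exists chp hW.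
- by move=> s1 s2 t1 t2 _ _ _ _; exact: is_restriction_comp.
- by move=> s1 s2 t a1 a2; exact: (restriction_inj chp hW a1 a2).
exact: restriction_jacobian chp perfect hW.
Qed.
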